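(* Consider the system $$N'(t)+a(t)N(t)=\sum_{i=1}^n b_i(t)e^{-\beta_i(t)N(t-m_i\omega)}\quad(0\le t\ne t_k),\qquad \Delta N(t_k):=N(t_k^+)-N(t_k)=b_kN(t_k)\quad(k=1,2,\dots),\tag{L}$$ in the setting described in the context, with $b_k>-1$ for all $k$, $t_{k+p}=t_k+\omega$ and $b_{k+p}=b_k$ for all $k\in\mathbb{N}$, and $\prod_{k=1}^p(1+b_k)\le1$. Let $N^*(t)$ be an $\omega$-periodic positive solution of (L). If $\alpha_1\alpha_2<1$, where $$\alpha_1=\sup_{t\in[0,\omega]}\frac1{N^*(t)}\int_{t-\bar m\omega}^t\sum_{i=1}^n b_i(s)\beta_i(s)N^*(s)e^{-\beta_i(s)N^*(s)-\int_s^ta(u)\,du}\prod_{k:\,s\le t_k<t}(1+b_k)\,ds,$$ $$\alpha_2=\sup_{t\in[0,\omega]}\frac1{N^*(t)}\int_{t-\bar m\omega}^t\sum_{i=1}^n b_i(s)\beta_i(s)N^*(s)e^{-\int_s^ta(u)\,du}\prod_{k:\,s\le t_k<t}(1+b_k)\,ds,$$ and $\bar m=\max_{1\le i\le n}m_i$, then $\lim_{t\to\infty}(N(t)-N^*(t))=0$ for any positive solution $N(t)$ of (L).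
   Context: Setting. $\omega>0$ and $n,p,m_1,\dots,m_n$ are positive integers. The functions $a,b_i,\beta_i:\mathbb{R}\to(0,\infty)$, $1\le i\le n$, are continuous, positive and $\omega$-periodic (the coefficient functions $b_i(t)$ are not to be confused with the impulse constants $b_k$). $0<t_1<t_2<\cdots<t_p<\omega$ and $t_k\to\infty$. In the products, $t_k$ and $b_k$ are extended to all integers $k$ by $t_{k+p}=t_k+\omega$, $b_{k+p}=b_k$, and $N^*$ is extended $\omega$-periodically to $\mathbb{R}$. An empty product equals 1. Solutions are left continuous and $N'(t)$ is the left-hand derivative. Positive solutions of (L) are the solutions with initial condition $N(\theta)=\phi(\theta)$ on $[-\bar m\omega,0]$, where $\phi:[-\bar m\omega,0]\to[0,\infty)$ is continuous with $\phi(0)>0$. *)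

(* Defs.v *)
From HB Require Import structures.
From mathcomp Require Import all_boot all_order all_algebra.
From mathcomp Require Import all_classical all_reals all_analysis.

Set Implicit Arguments.
Unset Strict Implicit.
Unset Printing Implicit Defensive.

Import Order.TTheory GRing.Theory Num.Theory.
Import numFieldNormedType.Exports.

Local Open Scope classical_set_scope.
Local Open Scope ring_scope.

Definition left_derivative (R : realType) (f : R -> R) (x l : R) : Prop :=
  h^-1 * (f (x + h) - f x) @[h --> (0 : R)^'-] --> l.

Definition max_delay (n : nat) (m : 'I_n -> nat) : nat := \max_(i < n) m i.

(* The index k runs over all integers; only t_1, ..., t_p lie in ]0, omega[. *)
Definition impulse_times (R : realType) (omega : R) (p : nat)
    (tau : int -> R) : Prop :=
  [/\ 0 < tau 1,
      forall j k : int, 1 <= j -> j < k -> k <= p%:Z -> tau j < tau k,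
      tau p%:Z < omega,
      forall k : int, tau (k + p%:Z) = tau k + omega &
      tau k%:Z @[k --> \oo] --> +oo].

(* The product over {k | s <= t_k < t}; the index set is finite for
   [impulse_times], and an empty product is 1. *)
Definition impulse_prod (R : realType) (tau c : int -> R) (s t : R) : R :=
  \big[*%R/1]_(k \in [set k : int | s <= tau k < t]) (1 + c k).

(* N is left continuous at every t > 0, continuous off the t_k (only on the
   right at t = 0), and jumps by c_k N(t_k) at t_k for k >= 1.
   As N' is a left-hand derivative, the equation is imposed for t > 0: at t = 0
   it would constrain the initial function, and the right-hand version of it at
   0 follows from the other clauses. The values on [-mbar omega, 0] are left
   free here, since those of a periodic solution may have jumps. *)
Definition solution (R : realType) (omega : R) (n : nat) (m : 'I_n -> nat)
    (a : R -> R) (b beta : 'I_n -> R -> R) (tau c : int -> R)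
    (N : R -> R) : Prop :=
  [/\ forall t : R, 0 < t -> N x @[x --> t^'-] --> N t,
      forall t : R, 0 <= t -> (forall k : int, t != tau k) ->
        N x @[x --> t^'+] --> N t,
      forall t : R, 0 < t -> (forall k : int, t != tau k) ->
        exists2 dN : R, left_derivative N t dN &
          dN + a t * N t =
          \sum_(i < n) b i t * expR (- beta i t * N (t - (m i)%:R * omega)) &
      forall k : int, 1 <= k ->
        exists2 Np : R, N x @[x --> (tau k)^'+] --> Np &
          Np - N (tau k) = c k * N (tau k)].

Definition initial_function (R : realType) (r : R) (phi : R -> R) : Prop :=
  [/\ {within `[- r, 0], continuous phi},
      forall x, x \in `[- r, 0] -> 0 <= phi x &
      0 < phi 0].

Definition positive_solution (R : realType) (omega : R) (n : nat)
    (m : 'I_n -> nat) (a : R -> R) (b beta : 'I_n -> R -> R)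
    (tau c : int -> R) (N : R -> R) : Prop :=
  solution omega m a b beta tau c N /\
  exists2 phi : R -> R, initial_function ((max_delay m)%:R * omega) phi &
    forall x, x \in `[- ((max_delay m)%:R * omega), 0] -> N x = phi x.

Definition periodic_positive_solution (R : realType) (omega : R) (n : nat)
    (m : 'I_n -> nat) (a : R -> R) (b beta : 'I_n -> R -> R)
    (tau c : int -> R) (Nstar : R -> R) : Prop :=
  [/\ periodic Nstar omega,
      forall t, 0 < Nstar t &
      solution omega m a b beta tau c Nstar].

Definition alpha1 (R : realType) (omega : R) (n : nat) (m : 'I_n -> nat)
    (a : R -> R) (b beta : 'I_n -> R -> R) (tau c : int -> R)
    (Nstar : R -> R) : R :=
  sup [set (Nstar t)^-1 *
      \int[lebesgue_measure]_(s in `[t - (max_delay m)%:R * omega, t])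
        (\sum_(i < n) b i s * beta i s * Nstar s *
           expR (- beta i s * Nstar s -
                 \int[lebesgue_measure]_(u in `[s, t]) a u) *
           impulse_prod tau c s t)
    | t in `[0, omega]].

Definition alpha2 (R : realType) (omega : R) (n : nat) (m : 'I_n -> nat)
    (a : R -> R) (b beta : 'I_n -> R -> R) (tau c : int -> R)
    (Nstar : R -> R) : R :=
  sup [set (Nstar t)^-1 *
      \int[lebesgue_measure]_(s in `[t - (max_delay m)%:R * omega, t])
        (\sum_(i < n) b i s * beta i s * Nstar s *
           expR (- \int[lebesgue_measure]_(u in `[s, t]) a u) *
           impulse_prod tau c s t)
    | t in `[0, omega]].

(* Main.v *)
Require Import Defs.
From HB Require Import structures.
From mathcomp Require Import all_boot all_order all_algebra.
From mathcomp Require Import all_classical all_reals all_analysis.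
From mathcomp Require Import measurable_realfun zify ring lra.

Set Implicit Arguments.
Unset Strict Implicit.
Unset Printing Implicit Defensive.

Import Order.TTheory GRing.Theory Num.Theory.
Import numFieldNormedType.Exports.

Local Open Scope classical_set_scope.
Local Open Scope ring_scope.

(** The relative deviation [z = N / Nstar - 1] has no jumps: at an impulse
    both [N] and [Nstar] are multiplied by the same [1 + c k].  Dividing the
    two equations gives, off the impulse times,
      [z' + g z = (f - fstar) / Nstar], with [g = fstar / Nstar],
    where [f] and [fstar] are the production terms of [N] and [Nstar]
    ([production], [equilibrium_production], and [pull] for [g]).  Since the
    delays are multiples of the period, [fstar] involves only the present
    value of [Nstar], and the sign and size of [f - fstar] are governed by the
    delayed values of [z].

    The two constants come from two ways of bounding this right-hand side.
    As [exp (- x)] is 1-Lipschitz on [x >= 0] and [z > -1], a bound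
    [z >= - L] gives at most [L * lipschitz_rate] ([gap_upper]); as [exp] lies
    above its tangents, a bound [z <= M] gives at least [- M * linear_rate]
    ([gap_lower]).  With [P s t] the propagator of [x' + a x = 0] with the
    impulses, [z * Nstar * P _ t] is continuous and its left derivative is the
    right-hand side times [Nstar * P _ t], so integrating from a zero of [z]
    over at most one maximal delay bounds [z] by [L * alpha2], and [- z] by
    [M * alpha1] ([window_estimate]).

    These bounds then hold for all later times ([overshoot]).  If [z] is
    positive, look at its last zero: up to one maximal delay after it the
    integral estimate applies; later all the delayed values are positive, so
    [z' <= 0].  Hence if [z] keeps returning to both sides of [0], the bounds
    improve alternately, starting from [z > -1]: eventually
    [- q ^ k <= z <= alpha2 * q ^ k] for every [k], with
    [q = alpha1 * alpha2 < 1] ([deviation_oscillating]).  If instead [z] is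
    eventually of one sign, then [z' + g z] has the opposite sign, and [z]
    tends to [0] because [g] is bounded below by a positive constant
    ([decay]).  Finally [N - Nstar = z * Nstar] with [Nstar] bounded.

    Derivatives are only left-hand derivatives, defined off a locally finite
    set, so monotonicity is obtained from real induction towards the left
    ([left_derivative_nonincreasing_off]). *)

(** * Left-hand derivatives and monotonicity *)
Section one_sided.
Variable R : realType.
Implicit Types (f g : R -> R) (a b s t l : R) (P X : R -> Prop).

Lemma near_leftP P s :
  (\forall r \near s^'-, P r) <-> exists2 r, r < s & forall y, r < y < s -> P y.
Proof.
split=> [[e /= e0 He]|[r rs Hr]].
- exists (s - e); first by rewrite ltrBlDr ltrDl.
  move=> y /andP[y1 y2]; apply: He => //=.
  by rewrite ger0_norm ?subr_ge0 ?ltW// ltrBlDl -ltrBlDr.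
- near=> y; apply: Hr; apply/andP; split; near: y.
  + exact: nbhs_left_gt.
  + exact: nbhs_left_lt.
Unshelve. all: by end_near. Qed.

Lemma near_rightP P s :
  (\forall r \near s^'+, P r) <-> exists2 r, s < r & forall y, s < y < r -> P y.
Proof.
split=> [[e /= e0 He]|[r rs Hr]].
- exists (s + e); first by rewrite ltrDl.
  move=> y /andP[y1 y2]; apply: He => //=.
  by rewrite ler0_norm ?subr_le0 ?ltW// opprB ltrBlDl.
- near=> y; apply: Hr; apply/andP; split; near: y.
  + exact: nbhs_right_gt.
  + exact: nbhs_right_lt.
Unshelve. all: by end_near. Qed.

(** The supremum of the counterexamples would itself violate one of the two
    propagation rules.  The induction runs to the left because a left
    derivative controls a function on the left of a point only. *)
Lemma downward_real_induction P a b :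
  P b ->
  (forall s, a < s <= b -> P s -> \forall r \near s^'-, a <= r -> P r) ->
  (forall s, a <= s < b -> (forall r, s < r <= b -> P r) -> P s) ->
  forall s, a <= s <= b -> P s.
Proof.
move=> Pb Pl Pr s /andP[as_ sb]; apply: contrapT => nPs.
pose A := [set r | a <= r <= b /\ ~ P r].
have As : A s by split=> //; rewrite as_ sb.
have supA : has_sup A by split; [exists s|exists b => r [/andP[]]].
pose c := sup A.
have sc : s <= c by apply: sup_upper_bound.
have cb : c <= b by apply: sup_le_ub; [exists s|move=> r [/andP[]]].
have Pgt r : c < r <= b -> P r.
  move=> /andP[cr rb]; apply: contrapT => nPr.
  have : r <= c.
    apply: sup_upper_bound => //; split => //.
    by rewrite rb andbT (le_trans as_)// (le_trans sc)// ltW.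
  by rewrite leNgt cr.
have Pc : P c.
  have := cb; rewrite le_eqVlt => /orP[/eqP E|cb']; first by rewrite E.
  by apply: Pr => //; rewrite cb' (le_trans as_).
have : s < c.
  by rewrite lt_neqAle sc andbT; apply/eqP => E; apply: nPs; rewrite E.
move=> {}sc.
have := Pl c; rewrite cb (le_lt_trans as_ sc).
move=> /(_ isT Pc)/near_leftP[r rc Hr].
suff : c <= Num.max r s by rewrite leNgt gt_max rc sc.
apply: sup_le_ub; first by exists s.
move=> x [/andP[ax xb] nPx]; rewrite leNgt; apply/negP => mx.
apply: nPx; have [cx|xc|<-//] := ltgtP c x; first by apply: Pgt; rewrite cx.
by apply: Hr => //; rewrite xc andbT (le_lt_trans _ mx)// le_max lexx.
Qed.

Lemma left_derivative_growth f s l e : left_derivative f s l -> l <= 0 ->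
  0 < e -> \forall r \near s^'-, f s <= f r + e * (s - r).
Proof.
move=> /cvgrPdist_lt/(_ e) fl l0 e0.
have /near_leftP[d d0 Hd] := fl e0.
apply/near_leftP; exists (s + d); first by rewrite gtrDl.
move=> y /andP[dy ys].
have := Hd (y - s); rewrite subr_lt0 ys andbT ltrBrDl => /(_ dy).
rewrite [s + _]addrC subrK => H.
have {}H : (y - s)^-1 * (f y - f s) < e.
  by move: H; rewrite ltr_norml => /andP[H _]; lra.
have ys0 : 0 < s - y by rewrite subr_gt0.
rewrite -lerBlDl -ler_pdivrMr//.
rewrite [X in X <= _](_ : _ = (y - s)^-1 * (f y - f s)); first exact: ltW.
have E : y - s != 0 by rewrite subr_eq0 lt_eqF.
have E' : s - y != 0 by rewrite subr_eq0 gt_eqF.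
by field; rewrite E E'.
Qed.

(** The slack [e' * (b - s)] turns a nonpositive left derivative into an
    inequality that really holds on some interval to the left of [s]. *)
Lemma left_derivative_nonincreasing f a b :
  (forall s, a < s <= b -> exists2 l, left_derivative f s l & l <= 0) ->
  (forall s, a <= s < b -> f x @[x --> s^'+] --> f s) ->
  a <= b -> f b <= f a.
Proof.
move=> df rc ab; apply/ler_addgt0Pr => e e0.
(* The summand [1] covers the case [a = b]. *)
pose e' := e / (b - a + 1).
have ba0 : 0 < b - a + 1 by rewrite ltr_wpDl// subr_ge0.
have e'0 : 0 < e' by rewrite divr_gt0.
suff H : forall s, a <= s <= b -> f b <= f s + e' * (b - s).
  apply: (le_trans (H a _)); first by rewrite lexx.
  rewrite lerD2l /e' mulrAC ler_pdivrMr// ler_pM2l//; lra.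
apply: downward_real_induction.
- by rewrite subrr mulr0 addr0.
- move=> s sab Hs; have [l dl l0] := df s sab.
  have := left_derivative_growth dl l0 e'0.
  apply: filterS => r Hr _; apply: (le_trans Hs).
  rewrite (_ : f r + _ = f r + e' * (s - r) + e' * (b - s)); last by ring.
  by rewrite lerD2r.
- move=> s /andP[as_ sb] H.
  have C : f r + e' * (b - r) @[r --> s^'+] --> f s + e' * (b - s).
    apply: cvgD; first by apply: rc; rewrite as_.
    apply: cvgM; first exact: cvg_cst.
    by apply: cvgB; [exact: cvg_cst|apply: cvg_at_right_filter; exact: cvg_id].
  apply: (cvgr_to_ge C); near=> r; apply: H; apply/andP; split.
  + by near: r; exact: nbhs_right_gt.
  + by near: r; exact: nbhs_right_le.
Unshelve. all: by end_near. Qed.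

Definition left_discrete X := forall s, \forall r \near s^'-, ~ X r.

(** To the left of every point there is a gap without exceptional points, in
    which the previous lemma applies; left continuity carries the inequality
    to the right end of the gap, exceptional or not. *)
Lemma left_derivative_nonincreasing_off X f a b :
  left_discrete X ->
  (forall s, a < s < b -> ~ X s ->
    exists2 l, left_derivative f s l & l <= 0) ->
  (forall s, a < s <= b -> f x @[x --> s^'-] --> f s) ->
  (forall s, a <= s < b -> f x @[x --> s^'+] --> f s) ->
  a <= b -> f b <= f a.
Proof.
move=> dX df lc rc ab.
apply: (@downward_real_induction (fun s => f b <= f s) a b) => //;
  last by rewrite lexx.
- move=> s /andP[as_ sb] Hs; have /near_leftP[d ds Hd] := dX s.
  apply/near_leftP; exists d => // r /andP[dr rs] ar.
  apply: (le_trans Hs).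
  have C : f x @[x --> s^'-] --> f s by apply: lc; rewrite as_.
  apply: (cvgr_to_le C); near=> q.
  have rq : r < q by near: q; exact: nbhs_left_gt.
  have qs : q < s by near: q; exact: nbhs_left_lt.
  apply: left_derivative_nonincreasing; last exact: ltW.
  + move=> x /andP[rx xq]; apply: df.
      by rewrite (le_lt_trans ar)//= (le_lt_trans xq)// (lt_le_trans qs).
    by apply: Hd; rewrite (lt_trans dr)//= (le_lt_trans xq).
  + move=> x /andP[rx xq]; apply: rc.
    by rewrite (le_trans ar)//= (lt_le_trans xq)// (le_trans (ltW qs)).
- move=> s /andP[as_ sb] H.
  apply: (cvgr_to_ge (rc s _)); first by rewrite as_.
  near=> r; apply: H; apply/andP; split.
  + by near: r; exact: nbhs_right_gt.
  + by near: r; exact: nbhs_right_le.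
Unshelve. all: by end_near. Qed.

Lemma left_derivative_lim f s l : left_derivative f s l ->
  f (s + h) @[h --> (0 : R)^'-] --> f s.
Proof.
move=> fl.
have C : f s + h * (h^-1 * (f (s + h) - f s)) @[h --> (0 : R)^'-] -->
    f s + 0 * l.
  apply: cvgD; first exact: cvg_cst.
  by apply: cvgM => //; apply: cvg_at_left_filter; exact: cvg_id.
rewrite mul0r addr0 in C; apply: cvg_trans C; apply: near_eq_cvg.
near=> h; have h0 : h != 0 by near: h; exact: nbhs_left_neq.
by rewrite mulrA divff// mul1r addrC subrK.
Unshelve. all: by end_near. Qed.

Lemma left_derivativeM f g s l k :
  left_derivative f s l -> left_derivative g s k ->
  left_derivative (fun x => f x * g x) s (l * g s + f s * k).
Proof.
move=> fl gk.
have C : (h^-1 * (f (s + h) - f s)) * g (s + h) +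
     f s * (h^-1 * (g (s + h) - g s)) @[h --> (0 : R)^'-] --> l * g s + f s * k.
  apply: cvgD; first by apply: cvgM => //; exact: left_derivative_lim gk.
  by apply: cvgM => //; exact: cvg_cst.
rewrite /left_derivative; apply: cvg_trans C; apply: near_eq_cvg.
by apply: nearW => h /=; ring.
Qed.

Lemma left_derivativeV g s k : g s != 0 -> left_derivative g s k ->
  left_derivative (fun x => (g x)^-1) s (- k / g s ^+ 2).
Proof.
move=> g0 gk.
have gs := left_derivative_lim gk.
have C : - (h^-1 * (g (s + h) - g s)) * ((g (s + h))^-1 * (g s)^-1)
     @[h --> (0 : R)^'-] --> - k * ((g s)^-1 * (g s)^-1).
  apply: cvgM; first exact: cvgN.
  by apply: cvgM; [exact: cvgV|exact: cvg_cst].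
rewrite -invfM -expr2 in C.
rewrite /left_derivative; apply: cvg_trans C; apply: near_eq_cvg.
have : \forall h \near (0 : R)^'-, g (s + h) != 0.
  exact: cvgr_neq0 gs g0.
apply: filterS2 (@nbhs_left_neq R 0) => h h0 g1.
by field; rewrite h0 g0 g1.
Qed.

Lemma left_derivativeB f g s l k :
  left_derivative f s l -> left_derivative g s k ->
  left_derivative (fun x => f x - g x) s (l - k).
Proof.
move=> fl gk; have C : h^-1 * (f (s + h) - f s) - h^-1 * (g (s + h) - g s)
     @[h --> (0 : R)^'-] --> l - k by exact: cvgB.
rewrite /left_derivative; apply: cvg_trans C; apply: near_eq_cvg.
by apply: nearW => h /=; rewrite /= -mulrBr; congr (_ * _); ring.
Qed.

Lemma left_derivative_cst k s : left_derivative (fun=> k) s 0.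
Proof.
rewrite /left_derivative subrr; under eq_fun do rewrite mulr0.
exact: cvg_cst.
Qed.

Lemma left_derivativeN f s l : left_derivative f s l ->
  left_derivative (fun x => - f x) s (- l).
Proof.
move=> fl; have := left_derivativeB (left_derivative_cst 0 s) fl.
by rewrite sub0r; under eq_fun do rewrite sub0r.
Qed.

Lemma is_derive_left_derivative f s l :
  is_derive s 1 f l -> left_derivative f s l.
Proof.
move=> [dfs <-]; apply: cvg_dnbhs_at_left.
have := dfs; rewrite /derivable => /cvg_ex[k Hk].
rewrite /derive (cvg_lim _ Hk)//; apply: cvg_trans Hk.
apply: near_eq_cvg; apply: nearW => h /=.
by rewrite /GRing.scale/= mulr1 [s + h]addrC.
Qed.

(** This is what makes factors that are locally constant on the left, such as
    the products over impulses, behave like constants. *)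
Lemma left_derivative_near f g s l :
  (\forall r \near s^'-, f r = g r) -> f s = g s ->
  left_derivative f s l -> left_derivative g s l.
Proof.
rewrite /left_derivative => /near_leftP[d ds Hd] fg fl.
apply: cvg_trans fl; apply: near_eq_cvg.
apply/near_leftP; exists (d - s); first by rewrite subr_lt0.
move=> h /andP[h1 h2]; rewrite fg Hd//.
by rewrite -ltrBlDl h1 gtrDl.
Qed.

Lemma left_derivative_shift f c s l :
  left_derivative f (s + c) l -> left_derivative (fun x => f (x + c)) s l.
Proof.
rewrite /left_derivative => fl; apply: cvg_trans fl.
by apply: near_eq_cvg; apply: nearW => h; rewrite addrAC.
Qed.

Lemma cvg_left_shift f c s l :
  f x @[x --> (s + c)^'-] --> l -> f (x + c) @[x --> s^'-] --> l.
Proof.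
move=> H; apply: cvg_trans H => A /near_leftP[d ds Hd].
apply/near_leftP; exists (d - c); first by rewrite ltrBlDr.
by move=> y /andP[y1 y2]; apply: Hd; rewrite -ltrBlDr y1 ltrD2r.
Qed.

Lemma cvg_right_shift f c s l :
  f x @[x --> (s + c)^'+] --> l -> f (x + c) @[x --> s^'+] --> l.
Proof.
move=> H; apply: cvg_trans H => A /near_rightP[d ds Hd].
apply/near_rightP; exists (d - c); first by rewrite ltrBrDr.
by move=> y /andP[y1 y2]; apply: Hd; apply/andP; split; lra.
Qed.

End one_sided.

(** * Integration of functions with countably many discontinuities *)
Section integration.
Variable R : realType.
Notation mu := (@lebesgue_measure R).
Implicit Types (f h phi : R -> R) (u v s t : R) (X D : set R).

(** Continuity would be too much to ask: this is applied to [Nstar], which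
    jumps at the impulse times. *)
Lemma locally_bounded_segment f u v :
  (forall x : R, exists M, \forall y \near x, f y <= M) ->
  exists M, forall x, u <= x <= v -> f x <= M.
Proof.
move=> fb; have cptK : @near_covering R [set` `[u, v]].
  by apply/compact_near_coveringP; exact: segment_compact.
have := cptK R (pinfty_nbhs R) (fun M x => f x <= M) _.
have H x : [set` `[u, v]] x -> \forall x' \near x & M \near +oo, f x' <= M.
  move=> _; have [M HM] := fb x.
  exists ([set y | f y <= M], [set M' | M <= M']).
    by split => //=; exact: nbhs_pinfty_ge (num_real M).
  by move=> [y M'] /= [/le_trans h1 /h1].
move=> /(_ _ H) [M [_ HM]]; exists (M + 1) => x xuv.
by apply: HM; [rewrite ltrDl|rewrite /= in_itv].
Qed.

Lemma measurable_fun_countable X f : countable X -> measurable_fun X f.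
Proof.
move=> cX _ Y mY; apply: countable_measurable => //.
exact: sub_countable (subset_card_le (@subIsetl _ _ _)) cX.
Qed.

Lemma measurable_fun_continuous_off D X f : measurable D -> countable X ->
  (forall x, D x -> ~ X x -> {for x, continuous f}) -> measurable_fun D f.
Proof.
move=> mD cX cf.
have mX : measurable X by apply: countable_measurable.
rewrite -(setDUK (@subIsetl _ D X)); apply/measurable_funU.
- exact: measurableI.
- by apply: measurableD => //; exact: measurableI.
split.
  apply: measurable_fun_countable.
  exact: sub_countable (subset_card_le (@subIsetr _ _ _)) cX.
apply: subspace_continuous_measurable_fun.
  by apply: measurableD => //; exact: measurableI.
apply: continuous_in_subspaceT => x /set_mem[Dx nX].
by apply: cf => // Xx; apply: nX.
Qed.

Lemma integrable_continuous_off X f u v M : countable X ->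
  (forall x, u < x < v -> ~ X x -> {for x, continuous f}) ->
  (forall x, u <= x <= v -> `|f x| <= M) ->
  mu.-integrable `[u, v] (EFin \o f).
Proof.
move=> cX cf fM; apply: measurable_bounded_integrable => //.
- by rewrite /= lebesgue_measure_itv/=; case: ifP => // _; rewrite -EFinB ltry.
- apply/measurable_fun_itv_bndo_bndcP/measurable_fun_itv_obnd_cbndP.
  exact: (@measurable_fun_continuous_off _ X).
- exists M; split; first exact: num_real.
  move=> K MK x /=; rewrite in_itv/= => uxv.
  by rewrite (le_trans (fM _ uxv))// ltW.
Qed.

(** At a point where [h] is continuous the primitive of [h] is differentiable,
    so [phi] minus that primitive has a nonpositive left derivative off [X];
    the primitive is continuous everywhere. *)
Lemma integral_growth X h phi u v :
  left_discrete X -> u <= v ->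
  mu.-integrable `[u, v] (EFin \o h) ->
  (forall s, u < s < v -> ~ X s -> {for s, continuous h}) ->
  (forall s, u < s <= v -> phi x @[x --> s^'-] --> phi s) ->
  (forall s, u <= s < v -> phi x @[x --> s^'+] --> phi s) ->
  (forall s, u < s < v -> ~ X s ->
    exists2 l, left_derivative phi s l & l <= h s) ->
  phi v - phi u <= \int[mu]_(s in `[u, v]) h s.
Proof.
move=> dX; rewrite le_eqVlt => /predU1P[<- _ _ _ _ _|uv].
  by rewrite subrr set_itv1 Rintegral_set1.
move=> ih ch lc rc dphi.
pose H x := \int[mu]_(t in `[u, x]) h t.
have := parameterized_integral_continuous (ltW uv) ih.
move=> /(continuous_within_itvP _ uv)[Hc Hu Hv].
have Hat x : u < x < v -> {for x, continuous H}.
  by move=> xuv; apply: Hc; rewrite in_itv.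
have := @left_derivative_nonincreasing_off R X (fun x => phi x - H x) u v dX.
have HuE : H u = 0 by rewrite /H set_itv1 Rintegral_set1.
rewrite HuE subr0 lerBlDr -lerBlDl; apply; last exact: ltW.
- move=> s suv nX; have [l dl lh] := dphi s suv nX.
  exists (l - h s); last by rewrite subr_le0.
  apply: left_derivativeB => //; apply: is_derive_left_derivative.
  have /andP[us sv] := suv.
  have [] := @continuous_FTC1_closed R h u s v sv ih us (ch s suv nX).
  rewrite -/H derive1E => dH <-; exact: DeriveDef.
- move=> s /andP[us sv]; apply: cvgB; first by apply: lc; rewrite us.
  move: sv; rewrite le_eqVlt => /predU1P[->//|sv].
  by apply: cvg_at_left_filter; apply: Hat; rewrite us.
- move=> s /andP[us sv]; apply: cvgB; first by apply: rc; rewrite us.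
  move: us; rewrite le_eqVlt => /predU1P[<-//|us].
  by apply: cvg_at_right_filter; apply: Hat; rewrite us.
Qed.

(** A single function [F] expresses the integral as a function of either end
    point; the propagator needs it as a function of the lower one. *)
Lemma antiderivative f u : continuous f ->
  exists F, (forall s, u < s -> is_derive s 1 F (f s)) /\
    forall s t, u < s -> s <= t -> \int[mu]_(x in `[s, t]) f x = F t - F s.
Proof.
move=> cf.
have intf s t : mu.-integrable `[s, t] (EFin \o f).
  apply: continuous_compact_integrable; first exact: segment_compact.
  exact: continuous_subspaceT.
exists (fun x => \int[mu]_(y in `[u, x]) f y); split.
  move=> s us.
  have [] := @continuous_FTC1_closed R f u s (s + 1) _ (intf _ _) us (cf s).
    by rewrite ltrDl.
  by rewrite derive1E => dH <-; exact: DeriveDef.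
move=> s t us st; rewrite Rintegral_itvB//; last first.
  by rewrite bnd_simp ltW.
rewrite Rintegral_itv_obnd_cbnd//.
by apply: integrableS (intf s t) => //; apply: subset_itvr; rewrite bnd_simp.
Qed.

End integration.

(** * Impulse times and products over impulses *)
Section impulses.
Variables (R : realType) (omega : R) (p : nat) (tau c : int -> R).
Hypotheses (omega_gt0 : 0 < omega) (p_gt0 : (0 < p)%N).
Hypothesis tauP : impulse_times omega p tau.
Hypothesis c_gtN1 : forall k : int, -1 < c k.
Hypothesis c_per : forall k : int, c (k + p%:Z) = c k.
Implicit Types (s r t : R) (j k q : int).

Definition impulse_points : set R := range tau.

Lemma int_shift (f : int -> R) (w : R) :
  (forall k, f (k + p%:Z) = f k + w) ->
  forall k q, f (k + q * p%:Z) = f k + q%:~R * w.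
Proof.
move=> fS; have fSn k (i : nat) : f (k + i%:Z * p%:Z) = f k + i%:R * w.
  elim: i => [|i IH]; first by rewrite !mul0r !addr0.
  by rewrite intS [1 + _]addrC mulrDl mul1r addrA fS IH -natr1 mulrDl mul1r
    addrA.
move=> k [i|i]; first by rewrite fSn.
have := fSn (k + Negz i * p%:Z) i.+1; rewrite NegzE mulNr subrK => ->.
by rewrite mulrNz mulNr addrK.
Qed.

Lemma tau_shift k q : tau (k + q * p%:Z) = tau k + q%:~R * omega.
Proof. by apply: int_shift; case: tauP. Qed.

Lemma c_shift k q : c (k + q * p%:Z) = c k.
Proof.
by rewrite (@int_shift c 0) ?mulr0 ?addr0// => k'; rewrite c_per addr0.
Qed.

(** Euclidean division of [k - 1] by [p] locates [tau k] strictly inside the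
    [q]-th period cell.  Finiteness and distinctness of the impulse times come
    from this, since the hypotheses order only [tau 1], ..., [tau p]. *)
Lemma tau_cell k : exists q i : int, [/\ k = i + q * p%:Z, 1 <= i, i <= p%:Z &
  q%:~R * omega < tau k < (q + 1)%:~R * omega].
Proof.
have p0 : p%:Z != 0 by rewrite -lt0n.
have [tau1 tau_mono taup _ _] := tauP.
pose i : int := ((k - 1) %% p%:Z)%Z + 1.
have i1 : 1 <= i by rewrite /i lerDr modz_ge0.
have ip : i <= p%:Z.
  have : ((k - 1) %% p%:Z)%Z < p%:Z by apply: ltz_pmod; rewrite ltz_nat.
  by rewrite /i lezD1.
have kE : k = i + ((k - 1) %/ p%:Z)%Z * p%:Z.
  have := divz_eq (k - 1) p%:Z; rewrite /i; lia.
exists ((k - 1) %/ p%:Z)%Z, i; split => //.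
have -> : tau k = tau i + ((k - 1) %/ p%:Z)%Z%:~R * omega.
  by rewrite {1}kE tau_shift.
have t1i : tau 1 <= tau i.
  move: i1; rewrite le_eqVlt => /predU1P[<-//|i1].
  by apply/ltW/tau_mono.
have tip : tau i <= tau p%:Z.
  move: ip; rewrite le_eqVlt => /predU1P[->//|ip].
  by apply/ltW/tau_mono.
rewrite intrD mulrDl mul1r.
have := lt_le_trans tau1 t1i; have := le_lt_trans tip taup.
by move=> *; apply/andP; split; lra.
Qed.

Lemma tau_inj : injective tau.
Proof.
move=> j k jk; have [_ tau_mono _ _ _] := tauP.
have [q [i [jE i1 ip /andP[t1 t2]]]] := tau_cell j.
have [q' [i' [kE i1' ip' /andP[t1' t2']]]] := tau_cell k.
have H (x y : int) : x%:~R * omega < y%:~R * omega -> x < y.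
  by rewrite ltr_pM2r// ltr_int.
have qq' : q = q'.
  have : q < q' + 1 by apply: H; rewrite (lt_trans t1)// jk.
  have : q' < q + 1 by apply: H; rewrite (lt_trans t1')// -jk.
  lia.
move: jk; rewrite jE kE !tau_shift qq' => /addIr ii'.
suff -> : i = i' by [].
have [l|l|//] := ltgtP i i'.
  by have := tau_mono _ _ i1 l ip'; rewrite ii' ltxx.
by have := tau_mono _ _ i1' l ip; rewrite ii' ltxx.
Qed.

Lemma finite_int_segment (lo hi : int) :
  finite_set [set k : int | lo <= k <= hi].
Proof.
apply: (@sub_finite_set _ _
  ((fun n : nat => lo + n%:Z) @` [set n | (n < `|hi - lo|.+1)%N])).
  move=> k /= /andP[k1 k2]; exists `|k - lo|%N; lia.
by apply: finite_image; exact: finite_II.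
Qed.

Lemma finite_impulses s t : finite_set [set k : int | s <= tau k < t].
Proof.
pose Q1 := Num.floor (s / omega) - 1; pose Q2 := Num.floor (t / omega) + 1.
apply: sub_finite_set (finite_int_segment (Q1 * p%:Z) ((Q2 + 1) * p%:Z)).
move=> k /= /andP[sk kt].
have [q [i [kE i1 ip /andP[t1 t2]]]] := tau_cell k.
have h1 : Q1 < q.
  rewrite /Q1 ltrBlDr floor_lt_int.
  by rewrite ltr_pdivrMr// (le_lt_trans sk).
have h2 : q < Q2.
  rewrite /Q2 ltzD1 floor_ge_int.
  by rewrite ler_pdivlMr// ltW// (lt_trans t1).
rewrite kE; nia.
Qed.

(** Only finitely many impulse times lie within distance [1] of [s], and a
    finite set is closed. *)
Lemma impulse_points_isolated s : \forall r \near s^', ~ impulse_points r.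
Proof.
pose B := (tau @` [set k | s - 1 <= tau k < s + 1]) `\ s.
have cB : closed B.
  apply: (iffLR (@accessible_finite_set_closed R)).
    by apply: hausdorff_accessible; exact: Rhausdorff.
  by apply: finite_setD; apply: finite_image; exact: finite_impulses.
have nB : \forall r \near s, ~ B r.
  by apply: (open_nbhs_nbhs (conj (closed_openC cB) _)) => -[_]; apply.
have ns : \forall r \near s, s - 1 <= r < s + 1.
  exists 1 => //= r /=; rewrite /ball_ ltr_norml => /andP[]; lra.
near=> r => -[k _ kr].
have rs : r != s by near: r; exact: nbhs_dnbhs_neq.
have sr : s - 1 <= r < s + 1 by near: r; exact: nbhs_dnbhs.
have : ~ B r by near: r; exact: nbhs_dnbhs.
by apply; split; [exists k; rewrite //= kr|exact/eqP].
Unshelve. all: by end_near. Qed.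

Lemma impulse_points_left_discrete : left_discrete impulse_points.
Proof.
move=> s; have := impulse_points_isolated s.
rewrite /at_left !near_withinE; apply: filterS => r H rs.
by apply: H; rewrite lt_eqF.
Qed.

Lemma impulse_prod_eq1 s t :
  (forall k, ~ s <= tau k < t) -> impulse_prod tau c s t = 1.
Proof.
move=> H; rewrite /impulse_prod (_ : [set k | _] = set0) ?fsbig_set0//.
by apply/seteqP; split => // k /= /H.
Qed.

Lemma impulse_prodtt t : impulse_prod tau c t t = 1.
Proof.
by apply: impulse_prod_eq1 => k /andP[] /le_lt_trans /[apply]; rewrite ltxx.
Qed.

Lemma impulse_prod_cat s r t : s <= r -> r <= t ->
  impulse_prod tau c s t = impulse_prod tau c s r * impulse_prod tau c r t.
Proof.
move=> sr rt; rewrite /impulse_prod.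
rewrite (_ : [set k | s <= tau k < t] =
    [set k | s <= tau k < r] `|` [set k | r <= tau k < t]).
  apply: fsbigU0; [exact: finite_impulses|exact: finite_impulses|].
  by move=> k /= [/andP[_ kr] /andP[rk _]]; move: kr; rewrite ltNge rk.
apply/seteqP; split => k /=.
  move=> /andP[-> ->]; rewrite andbT.
  by apply/orP; case: (ltP (tau k) r).
move=> [/andP[-> kr]|/andP[rk ->]]; first by rewrite (lt_le_trans kr).
by rewrite (le_trans sr).
Qed.

Lemma impulse_prod1 k t : tau k < t ->
  (forall j, ~ tau k < tau j < t) -> impulse_prod tau c (tau k) t = 1 + c k.
Proof.
move=> kt H; rewrite /impulse_prod (_ : [set j | _] = [set k]) ?fsbig_set1//.
apply/seteqP; split => j /=; last by move=> ->; rewrite lexx.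
move=> /andP[kj jt]; apply: tau_inj; apply/eqP; rewrite eq_le kj andbT leNgt.
by apply/negP => kj'; apply: (H j); rewrite kj'.
Qed.

Lemma impulse_prod_gt0 s t : 0 < impulse_prod tau c s t.
Proof.
rewrite /impulse_prod; apply: (big_ind (fun x : R => 0 < x)) => //.
  by move=> x y; exact: mulr_gt0.
by move=> k _; rewrite -ltrBlDl sub0r.
Qed.

(** As a function of its first argument the product is a left continuous step
    function; crossing [tau k] to the right divides it by [1 + c k], which is
    the inverse of the jump of a solution. *)
Lemma impulse_prod_near_left s t : s <= t ->
  \forall r \near s^'-, impulse_prod tau c r t = impulse_prod tau c s t.
Proof.
move=> st; have /near_leftP[d ds Hd] := impulse_points_left_discrete s.
apply/near_leftP; exists d => // r /andP[dr rs].
rewrite (@impulse_prod_cat r s t (ltW rs) st)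
  [impulse_prod _ _ r s]impulse_prod_eq1
  ?mul1r// => k.
move=> /andP[rk ks]; apply: (Hd (tau k)); last by exists k.
by rewrite ks (lt_le_trans dr).
Qed.

Lemma impulse_prod_near_right s t : s < t -> ~ impulse_points s ->
  \forall r \near s^'+, impulse_prod tau c r t = impulse_prod tau c s t.
Proof.
move=> st ns.
have : \forall r \near s^'+, ~ impulse_points r.
  have := impulse_points_isolated s.
  rewrite /at_right !near_withinE; apply: filterS => r H rs.
  by apply: H; rewrite gt_eqF.
move=> /near_rightP[d sd Hd]; apply/near_rightP.
exists (Num.min d t); first by rewrite lt_min sd.
move=> r /andP[sr]; rewrite lt_min => /andP[rd rt].
rewrite (@impulse_prod_cat s r t (ltW sr) (ltW rt))
  [impulse_prod _ _ s r]impulse_prod_eq1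
  ?mul1r// => k.
move=> /andP[sk kr]; move: sk; rewrite le_eqVlt => /predU1P[E|sk].
  by apply: ns; exists k.
by apply: (Hd (tau k)); [rewrite sk (lt_trans kr)|exists k].
Qed.

Lemma impulse_prod_jump k t : tau k < t ->
  \forall r \near (tau k)^'+,
    impulse_prod tau c r t = (1 + c k)^-1 * impulse_prod tau c (tau k) t.
Proof.
move=> kt.
have : \forall r \near (tau k)^'+, ~ impulse_points r.
  have := impulse_points_isolated (tau k).
  rewrite /at_right !near_withinE; apply: filterS => r H rs.
  by apply: H; rewrite gt_eqF.
move=> /near_rightP[d sd Hd]; apply/near_rightP.
exists (Num.min d t); first by rewrite lt_min sd.
move=> r /andP[sr]; rewrite lt_min => /andP[rd rt].
rewrite (@impulse_prod_cat (tau k) r t (ltW sr) (ltW rt)) impulse_prod1//.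
  rewrite mulKf// gt_eqF// -ltrBlDl sub0r; exact: c_gtN1.
move=> j /andP[kj jr].
by apply: (Hd (tau j)); [rewrite kj (lt_trans jr)|exists j].
Qed.

End impulses.

(** * Linear equations with impulses *)
Section propagation.
Variables (R : realType) (omega : R) (p : nat) (tau c : int -> R) (a : R -> R).
Hypotheses (omega_gt0 : 0 < omega) (p_gt0 : (0 < p)%N).
Hypothesis tauP : impulse_times omega p tau.
Hypothesis c_gtN1 : forall k : int, -1 < c k.
Hypothesis a_cont : continuous a.
Notation mu := (@lebesgue_measure R).
Implicit Types (s r t : R) (f x : R -> R).

(** The factor by which a solution of [x' + a x = 0] with the impulses is
    multiplied from time [s] to time [t]. *)
Definition propagator s t :=
  expR (- \int[mu]_(u in `[s, t]) a u) * impulse_prod tau c s t.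

(** The forcing [f] is a given function of time: putting the delayed terms
    into it lets [N] and [Nstar] be treated as solutions of linear equations,
    from [s0] on. *)
Definition impulsive_solution (s0 : R) f x :=
  [/\ forall t, s0 < t -> x y @[y --> t^'-] --> x t,
      forall t, s0 <= t -> ~ impulse_points tau t ->
        x y @[y --> t^'+] --> x t,
      forall t, s0 < t -> ~ impulse_points tau t ->
        left_derivative x t (f t - a t * x t) &
      forall k, s0 <= tau k ->
        x y @[y --> (tau k)^'+] --> (1 + c k) * x (tau k)].

Lemma propagatortt t : propagator t t = 1.
Proof.
by rewrite /propagator set_itv1 Rintegral_set1 oppr0 expR0 impulse_prodtt mul1r.
Qed.

Lemma propagator_gt0 s t : 0 < propagator s t.
Proof. by rewrite mulr_gt0 ?expR_gt0// impulse_prod_gt0. Qed.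

Lemma propagator_antiderivative (s0 : R) : exists F : R -> R,
  (forall s, s0 < s -> is_derive s 1 F (a s)) /\
  forall s t, s0 < s -> s <= t ->
    propagator s t = expR (F s - F t) * impulse_prod tau c s t.
Proof.
have [F [F1 F2]] := antiderivative s0 a_cont.
exists F; split => // s t s0s st.
by rewrite /propagator F2// opprB.
Qed.

Lemma is_derive_continuous F s l : is_derive s (1 : R) F l ->
  F x @[x --> s] --> (F s : R).
Proof. by move=> [dF _]; exact/differentiable_continuous/derivable1_diffP. Qed.

Variables (s0 : R) (f x : R -> R).
Hypothesis x_sol : impulsive_solution s0 f x.

(** The next three lemmas say that the propagator is an integrating factor:
    [x * propagator _ t] is continuous and its derivative no longer involves
    [x]. *)
Lemma propagated_left_cvg t s : s0 < s -> s <= t ->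
  x r * propagator r t @[r --> s^'-] --> x s * propagator s t.
Proof.
move=> s0s st; have [F [dF PE]] := propagator_antiderivative s0.
have [xl _ _ _] := x_sol.
rewrite PE//.
have C : x r * (expR (F r - F t) * impulse_prod tau c s t) @[r --> s^'-] -->
   x s * (expR (F s - F t) * impulse_prod tau c s t).
  apply: cvgM; first exact: xl.
  apply: cvgM; last exact: cvg_cst.
  apply: cvg_at_left_filter; apply: continuous_cvg.
    exact: continuous_expR.
  by apply: cvgB; [exact: is_derive_continuous (dF _ s0s)|exact: cvg_cst].
apply: cvg_trans C; apply: near_eq_cvg.
near=> r.
have rs : r < s by near: r; exact: nbhs_left_lt.
rewrite PE; [|by near: r; exact: nbhs_left_gt|exact/ltW/(lt_le_trans rs)].
congr (_ * (_ * _)); apply/esym.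
by near: r; exact: (impulse_prod_near_left _ omega_gt0 p_gt0 tauP).
Unshelve. all: by end_near. Qed.

(** At an impulse, [x] is multiplied by [1 + c k] and the propagator divided
    by it. *)
Lemma propagated_right_cvg t s : s0 <= s -> s < t ->
  x r * propagator r t @[r --> s^'+] --> x s * propagator s t.
Proof.
move=> s0s st; have [F [dF PE]] := propagator_antiderivative (s0 - 1).
have s1s : s0 - 1 < s by lra.
have [_ xr _ xj] := x_sol.
rewrite PE//; last exact: ltW.
have C q : expR (F r - F t) * q @[r --> s^'+] --> expR (F s - F t) * q.
  apply: cvgM; last exact: cvg_cst.
  apply: cvg_at_right_filter; apply: continuous_cvg.
    exact: continuous_expR.
  by apply: cvgB; [exact: is_derive_continuous (dF _ s1s)|exact: cvg_cst].
have [[k _ sk]|ns] := pselect (impulse_points tau s).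
- rewrite -sk in s0s st s1s C *.
  have c1 : 1 + c k != 0 by rewrite gt_eqF// -ltrBlDl sub0r; exact: c_gtN1.
  pose q := (1 + c k)^-1 * impulse_prod tau c (tau k) t.
  have {}C : x r * (expR (F r - F t) * q) @[r --> (tau k)^'+] -->
      (1 + c k) * x (tau k) * (expR (F (tau k) - F t) * q).
    exact: cvgM (xj k s0s) (C q).
  have EQ : (1 + c k) * x (tau k) *
      (expR (F (tau k) - F t) * q) =
      x (tau k) * (expR (F (tau k) - F t) * impulse_prod tau c (tau k) t).
    by rewrite /q; field.
  rewrite -EQ; apply: cvg_trans C; apply: near_eq_cvg.
  near=> r.
  have sr : tau k < r by near: r; exact: nbhs_right_gt.
  rewrite PE; [|exact: lt_trans sr|by near: r; exact: nbhs_right_le].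
  congr (_ * (_ * _)); apply/esym.
  by near: r; exact: (impulse_prod_jump omega_gt0 p_gt0 tauP).
- pose q := impulse_prod tau c s t.
  have {}C : x r * (expR (F r - F t) * q) @[r --> s^'+] -->
      x s * (expR (F s - F t) * q) by exact: cvgM (xr s s0s ns) (C q).
  apply: cvg_trans C; apply: near_eq_cvg.
  near=> r.
  have sr : s < r by near: r; exact: nbhs_right_gt.
  rewrite PE; [|exact: lt_trans sr|by near: r; exact: nbhs_right_le].
  congr (_ * (_ * _)); apply/esym.
  by near: r; exact: (impulse_prod_near_right _ omega_gt0 p_gt0 tauP).
Unshelve. all: by end_near. Qed.

Lemma propagated_left_derivative t s : s0 < s -> s <= t ->
  ~ impulse_points tau s ->
  left_derivative (fun r => x r * propagator r t) s (propagator s t * f s).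
Proof.
move=> s0s st ns; have [F [dF PE]] := propagator_antiderivative s0.
have [_ _ xd _] := x_sol.
pose q := impulse_prod tau c s t.
have dFs : is_derive s (1 : R) (fun r => F r - F t) (a s).
  by rewrite -[a s]subr0; apply: is_deriveB; exact: dF.
have dE : is_derive s (1 : R) (expR \o (fun r => F r - F t))
    (a s * expR (F s - F t)).
  rewrite mulrC; apply: is_derive1_comp.
have D := left_derivativeM (xd s s0s ns)
  (left_derivativeM (is_derive_left_derivative dE) (left_derivative_cst q s)).
have EQ : (f s - a s * x s) * (expR (F s - F t) * q) +
   x s * (a s * expR (F s - F t) * q + expR (F s - F t) * 0) =
   propagator s t * f s.
  by rewrite PE// -/q; ring.
rewrite EQ in D; apply: left_derivative_near D; last by rewrite PE.
near=> r.
have rs : r < s by near: r; exact: nbhs_left_lt.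
rewrite PE; [|by near: r; exact: nbhs_left_gt|exact/ltW/(lt_le_trans rs)].
congr (_ * (_ * _)); apply/esym.
by near: r; exact: (impulse_prod_near_left _ omega_gt0 p_gt0 tauP).
Unshelve. all: by end_near. Qed.

Lemma propagated_le t s : (forall r, s0 < r -> 0 <= f r) -> s0 <= s -> s <= t ->
  x s * propagator s t <= x t.
Proof.
move=> f0 s0s st.
suff : x s * propagator s t <= x t * propagator t t.
  by rewrite propagatortt mulr1.
rewrite -lerN2.
apply: (@left_derivative_nonincreasing_off R (impulse_points tau)
  (fun r => - (x r * propagator r t))) => //.
- exact: (impulse_points_left_discrete omega_gt0 p_gt0 tauP).
- move=> r /andP[sr rt] nr; exists (- (propagator r t * f r)).
    apply: left_derivativeN; apply: propagated_left_derivative => //.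
      exact: le_lt_trans sr.
    exact: ltW.
  rewrite oppr_le0; apply: mulr_ge0; first exact/ltW/propagator_gt0.
  by apply: f0; exact: le_lt_trans sr.
- move=> r /andP[sr rt]; apply: cvgN; apply: propagated_left_cvg => //.
  exact: le_lt_trans sr.
- move=> r /andP[sr rt]; apply: cvgN; apply: propagated_right_cvg => //.
  exact: le_trans sr.
Qed.

End propagation.

(** * The periodic solution *)
Section periodic_solution.
Variables (R : realType) (omega : R) (n p : nat) (m : 'I_n -> nat)
  (a : R -> R) (b beta : 'I_n -> R -> R) (tau c : int -> R) (Nstar : R -> R).
Hypotheses (omega_gt0 : 0 < omega) (p_gt0 : (0 < p)%N).
Hypotheses (a_cont : continuous a) (a_per : periodic a omega).
Hypotheses (b_cont : forall i, continuous (b i)) (b_gt0 : forall i t, 0 < b i t)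
  (b_per : forall i, periodic (b i) omega).
Hypotheses (beta_cont : forall i, continuous (beta i))
  (beta_gt0 : forall i t, 0 < beta i t)
  (beta_per : forall i, periodic (beta i) omega).
Hypothesis tauP : impulse_times omega p tau.
Hypothesis c_gtN1 : forall k : int, -1 < c k.
Hypothesis c_per : forall k : int, c (k + p%:Z) = c k.
Hypothesis NstarP : periodic_positive_solution omega m a b beta tau c Nstar.
Notation mu := (@lebesgue_measure R).
Implicit Types (s r t : R) (N w kappa : R -> R).

Let delay := (max_delay m)%:R * omega.
Let points := impulse_points tau.

Definition production N t : R :=
  \sum_(i < n) b i t * expR (- beta i t * N (t - (m i)%:R * omega)).

Lemma solution_impulsive N : solution omega m a b beta tau c N ->
  impulsive_solution tau c a 0 (production N) N.
Proof.
move=> [lc rc dN jp]; split => //.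
- by move=> t t0 nt; apply: rc => // k; apply/eqP => E; apply: nt; exists k.
- move=> t t0 nt; have [||l dl E] := dN t => //.
    by move=> k; apply/eqP => E; apply: nt; exists k.
  by rewrite /production -E addrK.
- move=> k tk.
  have [q [i [kE i1 ip /andP[_ tq]]]] := tau_cell omega_gt0 p_gt0 tauP k.
  have q0 : 0 <= q.
    have := le_lt_trans tk tq; rewrite pmulr_lgt0// ltr0z; lia.
  have k1 : 1 <= k by rewrite kE; nia.
  have [Np cNp E] := jp k k1.
  by rewrite mulrDl mul1r -E addrC subrK.
Qed.

Let Nstar_per : periodic Nstar omega. Proof. by case: NstarP. Qed.
Lemma Nstar_gt0 t : 0 < Nstar t. Proof. by case: NstarP. Qed.

Lemma periodicz (f : R -> R) (q : int) t :
  periodic f omega -> f (t + q%:~R * omega) = f t.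
Proof.
move=> fper; have fn (j : nat) u : f (u + j%:R * omega) = f u.
  by rewrite mulr_natl periodicn.
case: q => q; first exact: fn.
by rewrite NegzE mulrNz mulNr -(fn q.+1) subrK.
Qed.

Lemma periodic_subn (f : R -> R) (j : nat) t :
  periodic f omega -> f (t - j%:R * omega) = f t.
Proof. by move=> fper; rewrite -(periodicz j (t - _) fper) subrK. Qed.

Lemma points_shift (q : int) t : points (t + q%:~R * omega) -> points t.
Proof.
move=> [k _ kt]; exists (k + (- q) * p%:Z) => //.
by rewrite (tau_shift tauP) kt mulrNz mulNr addrK.
Qed.

Definition equilibrium_production t : R :=
  \sum_(i < n) b i t * expR (- beta i t * Nstar t).

Lemma equilibrium_production_per : periodic equilibrium_production omega.
Proof.
move=> t; apply: eq_bigr => i _.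
by rewrite b_per beta_per Nstar_per.
Qed.

Lemma equilibrium_production_ge0 t : 0 <= equilibrium_production t.
Proof. by apply: sumr_ge0 => i _; rewrite mulr_ge0 ?expR_ge0// ltW. Qed.

Lemma production_Nstar t : production Nstar t = equilibrium_production t.
Proof. by apply: eq_bigr => i _; rewrite (periodic_subn _ _ Nstar_per). Qed.

(** The equation is assumed for positive times only; translating by a whole
    number of periods extends it to the line, where the windows
    [[t - delay, t]] with [t] in [[0, omega]] need it. *)
Lemma Nstar_impulsive (s0 : R) :
  impulsive_solution tau c a s0 equilibrium_production Nstar.
Proof.
have [_ _ /solution_impulsive[lc rc dN jp]] := NstarP.
have far t : exists q : int, 0 < t + q%:~R * omega.
  exists (Num.floor (- t / omega) + 1).
  have := lt_succ_floor (- t / omega).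
  by rewrite ltr_pdivrMr// => H; rewrite -ltrBlDl sub0r.
have shiftE (q : int) : (fun x => Nstar (x + q%:~R * omega)) = Nstar.
  by apply/funext => x; rewrite periodicz.
split.
- move=> t _; have [q tq] := far t.
  by have := cvg_left_shift (lc _ tq); rewrite shiftE periodicz.
- move=> t _ nt; have [q tq] := far t.
  have nq : ~ impulse_points tau (t + q%:~R * omega).
    by move=> /points_shift.
  by have := cvg_right_shift (rc _ (ltW tq) nq); rewrite shiftE periodicz.
- move=> t _ nt; have [q tq] := far t.
  have nq : ~ impulse_points tau (t + q%:~R * omega).
    by move=> /points_shift.
  have := left_derivative_shift (dN _ tq nq).
  rewrite shiftE production_Nstar !periodicz//.
  exact: equilibrium_production_per.
- move=> k _; have [q tq] := far (tau k).
  rewrite -(tau_shift tauP) in tq.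
  have := jp _ (ltW tq).
  rewrite (tau_shift tauP) (c_shift c_per) => /cvg_right_shift.
  by rewrite shiftE periodicz.
Qed.

Lemma Nstar_cont s : ~ points s -> {for s, continuous Nstar}.
Proof.
move=> ns; have [lc rc _ _] := Nstar_impulsive (s - 1).
by apply/left_right_continuousP; split; [apply: lc|apply: rc => //]; lra.
Qed.

Lemma period_reduction t : exists (q : int) t0,
  t = t0 + q%:~R * omega /\ 0 <= t0 <= omega.
Proof.
exists (Num.floor (t / omega)), (t - (Num.floor (t / omega))%:~R * omega).
split; first by rewrite subrK.
have h1 : (Num.floor (t / omega))%:~R * omega <= t.
  by rewrite -ler_pdivlMr// floor_le.
have h2 : t < ((Num.floor (t / omega)) + 1)%:~R * omega.
  by rewrite -ltr_pdivrMr// lt_succ_floor.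
rewrite intrD mulrDl mul1r in h2.
by apply/andP; split; lra.
Qed.

Lemma continuous_periodic_bounded (f : R -> R) : continuous f ->
  periodic f omega -> exists M, forall t, f t <= M.
Proof.
move=> cf fper.
have [M HM] : exists M, forall t, 0 <= t <= omega -> f t <= M.
  apply: locally_bounded_segment => x.
  by exists (f x + 1); have /cvgr_le := cf x; apply; rewrite ltrDl.
exists M => t; have [q [t0 [-> t0o]]] := period_reduction t.
by rewrite periodicz//; exact: HM.
Qed.

(** The one-sided limits bound [Nstar] near every point. *)
Lemma Nstar_bounded : exists2 M, 0 < M & forall t, Nstar t <= M.
Proof.
have [M HM] : exists M, forall t, 0 <= t <= omega -> Nstar t <= M.
  apply: (@locally_bounded_segment R Nstar) => x.
  have [lc rc _ jp] := Nstar_impulsive (x - 1).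
  have [l rl] : exists l : R, Nstar y @[y --> x^'+] --> l.
    have [[k _ kx]|nx] := pselect (points x).
      by exists ((1 + c k) * Nstar x); rewrite -kx; apply: jp; lra.
    by exists (Nstar x); apply: rc => //; lra.
  exists (Num.max l (Nstar x) + 1).
  have h1 : l < Num.max l (Nstar x) + 1.
    by rewrite (@le_lt_trans _ _ (Num.max l (Nstar x)))// ?le_max ?lexx// ltrDl.
  have h2 : Nstar x < Num.max l (Nstar x) + 1.
    rewrite (@le_lt_trans _ _ (Num.max l (Nstar x)))// ?le_max ?lexx ?orbT//.
    by rewrite ltrDl.
  have /cvgr_le/(_ _ h2) : Nstar y @[y --> x^'-] --> Nstar x by apply: lc; lra.
  have /cvgr_le/(_ _ h1) := rl.
  rewrite !near_withinE => H1 H2; apply: filterS2 H1 H2 => y H1 H2.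
  by have [/H1|/H2|<-] := ltgtP x y => //; exact: ltW.
exists (Num.max M 1); first by rewrite lt_max ltr01 orbT.
move=> t; have [q [t0 [-> t0o]]] := period_reduction t.
by rewrite periodicz// le_max HM.
Qed.

Lemma delay_ge0 : 0 <= delay.
Proof. by rewrite mulr_ge0 ?ler0n// ltW. Qed.

Lemma delay_le i : (m i)%:R * omega <= delay.
Proof. by rewrite ler_pM2r// ler_nat; exact: (@leq_bigmax_cond _ xpredT m). Qed.

(** The coefficient of [z] in the equation of the relative deviation; it is
    also the left-hand logarithmic derivative of [weight t] off the impulse
    times. *)
Definition pull t := equilibrium_production t / Nstar t.

Lemma pull_per : periodic pull omega.
Proof. by move=> t; rewrite /pull equilibrium_production_per Nstar_per. Qed.

(** Unlike its two factors, [weight t] is continuous on the left of [t]; it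
    is nondecreasing there, up to [weight t t = Nstar t]. *)
Definition weight t s := Nstar s * propagator tau c a s t.

Lemma weight_ge0 t s : 0 <= weight t s.
Proof. by rewrite mulr_ge0 ?ltW ?Nstar_gt0 ?propagator_gt0. Qed.

Lemma weight_le t s : s <= t -> weight t s <= Nstar t.
Proof.
move=> st; apply: (propagated_le omega_gt0 p_gt0 tauP c_gtN1 a_cont
  (Nstar_impulsive (s - 1))) => //; last by lra.
by move=> r _; exact: equilibrium_production_ge0.
Qed.

Lemma weight_left_cvg t s : s <= t -> weight t r @[r --> s^'-] --> weight t s.
Proof.
move=> st; apply: (propagated_left_cvg omega_gt0 p_gt0 tauP a_cont
  (Nstar_impulsive (s - 1))) => //; lra.
Qed.

Lemma weight_right_cvg t s : s < t -> weight t r @[r --> s^'+] --> weight t s.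
Proof.
move=> st; apply: (propagated_right_cvg omega_gt0 p_gt0 tauP c_gtN1 a_cont
  (Nstar_impulsive (s - 1))) => //; lra.
Qed.

(** * Bounds over one window of delays *)

(** [kappa] stands for the two rates that bound the right-hand side of the
    equation of [z] from above and from below; [gain] is the constant
    [alpha2] or [alpha1] accordingly. *)
Section window.
Variables (kappa : R -> R) (K : R).
Hypothesis kappa_cont : forall s, ~ points s -> {for s, continuous kappa}.
Hypothesis kappa_ge0 : forall s, 0 <= kappa s.
Hypothesis kappa_le : forall s, kappa s <= K.
Hypothesis kappa_per : periodic kappa omega.

Definition window_mean t := (Nstar t)^-1 *
  \int[mu]_(s in `[t - delay, t]) (kappa s * weight t s).

Definition gain := sup [set window_mean t | t in `[0, omega]].

Lemma kernel_cont t s : s < t -> ~ points s ->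
  {for s, continuous (fun r => kappa r * weight t r)}.
Proof.
move=> st ns; apply: cvgM; first exact: kappa_cont.
apply/left_right_continuousP; split; first exact/weight_left_cvg/ltW.
exact: weight_right_cvg.
Qed.

Lemma kernel_le t s : s <= t -> kappa s * weight t s <= K * Nstar t.
Proof.
move=> st.
by apply: ler_pM; rewrite ?kappa_ge0 ?weight_ge0 ?kappa_le ?weight_le.
Qed.

Lemma kernel_ge0 t s : 0 <= kappa s * weight t s.
Proof. by rewrite mulr_ge0 ?kappa_ge0 ?weight_ge0. Qed.

Lemma kernel_integrable u t :
  mu.-integrable `[u, t] (EFin \o (fun s => kappa s * weight t s)).
Proof.
apply: (@integrable_continuous_off _ points _ _ _ (K * Nstar t)).
- exact: sub_countable (card_image_le _ _) (countableP _).
- by move=> s /andP[_ st] ns; exact: kernel_cont.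
- by move=> s /andP[_ st]; rewrite ger0_norm ?kernel_ge0// kernel_le.
Qed.

Lemma window_mean_ge0 t : 0 <= window_mean t.
Proof.
apply: mulr_ge0; first by rewrite invr_ge0 ltW// Nstar_gt0.
by apply: Rintegral_ge0 => s _; exact: kernel_ge0.
Qed.

(** This makes [gain] a genuine least upper bound: the supremum of an unbounded
    set of reals would be [0] by convention. *)
Lemma window_mean_le t : window_mean t <= K * delay.
Proof.
rewrite /window_mean mulrC ler_pdivrMr ?Nstar_gt0//.
have : \int[mu]_(s in `[t - delay, t]) (kappa s * weight t s) <=
       \int[mu]_(s in `[t - delay, t]) (K * Nstar t).
  apply: le_Rintegral => //.
  - exact: kernel_integrable.
  - apply: continuous_compact_integrable; first exact: segment_compact.
    by apply: continuous_subspaceT => x; exact: cvg_cst.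
  - by move=> s /=; rewrite in_itv/= => /andP[_ st]; exact: kernel_le.
move=> /le_trans; apply.
rewrite Rintegral_cst//= lebesgue_measure_itv/= lte_fin.
have [_|] := ltP; first by rewrite -EFinB/= opprB addrC subrK mulrAC.
rewrite /= mulr0 => _; apply: mulr_ge0; last exact/ltW/Nstar_gt0.
apply: mulr_ge0; last exact: delay_ge0.
exact: le_trans (kappa_ge0 0) (kappa_le 0).
Qed.

Lemma window_mean_le_gain t : 0 <= t <= omega -> window_mean t <= gain.
Proof.
move=> t0o; apply: sup_upper_bound; last by exists t; rewrite //= in_itv.
split; first by exists (window_mean t), t; rewrite //= in_itv.
by exists (K * delay) => _ [u _ <-]; exact: window_mean_le.
Qed.

Lemma gain_ge0 : 0 <= gain.
Proof.
apply: le_trans (window_mean_ge0 0) (window_mean_le_gain _).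
by rewrite lexx ltW.
Qed.

(** [w * weight t] is nonpositive at [u], equals [w t * Nstar t] at [t], and
    its left derivative is at most [L * kappa * weight t]. *)
Lemma window_estimate_base w L u t : 0 <= t <= omega -> t - delay <= u <= t ->
  0 <= L -> w u <= 0 ->
  (forall s, u < s <= t -> w r @[r --> s^'-] --> w s) ->
  (forall s, u <= s < t -> w r @[r --> s^'+] --> w s) ->
  (forall s, u < s < t -> ~ points s -> exists2 l, left_derivative w s l &
     l + pull s * w s <= L * kappa s) ->
  w t <= L * gain.
Proof.
move=> t0o /andP[du ut] L0 wu lc rc dw.
have ikut : mu.-integrable `[u, t]
    (EFin \o (fun s => L * (kappa s * weight t s))).
  apply: (@integrable_continuous_off _ points _ _ _ (L * (K * Nstar t))).
  - exact: sub_countable (card_image_le _ _) (countableP _).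
  - move=> s /andP[_ st] ns; apply: cvgM; first exact: cvg_cst.
    exact: kernel_cont.
  - move=> s /andP[_ st]; rewrite ger0_norm.
      by rewrite ler_wpM2l// kernel_le.
    by apply: mulr_ge0 => //; exact: kernel_ge0.
have := @integral_growth R points (fun s => L * (kappa s * weight t s))
  (fun s => w s * weight t s) u t.
move=> /(_ (impulse_points_left_discrete omega_gt0 p_gt0 tauP) ut ikut).
have H1 s : u < s < t -> ~ points s ->
    {for s, continuous (fun s => L * (kappa s * weight t s))}.
  move=> /andP[_ st] ns; apply: cvgM; first exact: cvg_cst.
  exact: kernel_cont.
have H2 s : u < s <= t ->
    (w r * weight t r) @[r --> s^'-] --> w s * weight t s.
  move=> /andP[us st]; apply: cvgM; last exact: weight_left_cvg.
  by apply: lc; rewrite us.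
have H3 s : u <= s < t ->
    (w r * weight t r) @[r --> s^'+] --> w s * weight t s.
  move=> /andP[us st]; apply: cvgM; last exact: weight_right_cvg.
  by apply: rc; rewrite us.
have H4 s : u < s < t -> ~ points s ->
    exists2 l, left_derivative (fun r => w r * weight t r) s l &
      l <= L * (kappa s * weight t s).
  move=> ust ns; have [l dl lL] := dw s ust ns.
  move/andP: ust => [us st].
  have dE := propagated_left_derivative omega_gt0 p_gt0 tauP a_cont
    (Nstar_impulsive (s - 1)) (t := t) (s := s).
  have {}dE := dE ltac:(lra) (ltW st) ns.
  eexists; first exact: left_derivativeM dl dE.
  have -> : l * (Nstar s * propagator tau c a s t) +
     w s * (propagator tau c a s t * equilibrium_production s) =
     (l + pull s * w s) * weight t s.
    by rewrite /pull /weight; field; rewrite gt_eqF ?Nstar_gt0.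
  rewrite [leRHS]mulrA; by apply: ler_wpM2r lL; exact: weight_ge0.
move=> /(_ H1 H2 H3 H4) H.
have E : weight t t = Nstar t by rewrite /weight propagatortt mulr1.
rewrite E in H.
have {}H : w t * Nstar t <= L * \int[mu]_(s in `[u, t]) (kappa s * weight t s).
  rewrite -RintegralZl//; last exact: kernel_integrable.
  apply: le_trans H; rewrite lerDl oppr_ge0 mulr_le0_ge0//.
  exact: weight_ge0.
have mono : \int[mu]_(s in `[u, t]) (kappa s * weight t s) <=
    \int[mu]_(s in `[t - delay, t]) (kappa s * weight t s).
  have := @Rintegral_itvB R (fun s => kappa s * weight t s)
    (BLeft (t - delay)) (BRight t) u (kernel_integrable _ _).
  rewrite !bnd_simp => /(_ du ut).
  rewrite Rintegral_itv_obnd_cbnd; last first.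
    apply: integrableS (kernel_integrable u t) => //.
    by apply: subset_itvr; rewrite bnd_simp.
  move=> <-; rewrite gerBl.
  by apply: Rintegral_ge0 => s _; exact: kernel_ge0.
have := window_mean_le_gain t0o.
rewrite /window_mean mulrC ler_pdivrMr ?Nstar_gt0// => Hg.
rewrite -(ler_pM2r (Nstar_gt0 t)) -mulrA.
apply: (le_trans H); apply: ler_wpM2l => //.
exact: le_trans mono Hg.
Qed.

(** The gain is defined by windows ending in [[0, omega]]; translating [w]
    rather than the integrals moves an arbitrary window there. *)
Lemma window_estimate w L u t : t - delay <= u <= t ->
  0 <= L -> w u <= 0 ->
  (forall s, u < s <= t -> w r @[r --> s^'-] --> w s) ->
  (forall s, u <= s < t -> w r @[r --> s^'+] --> w s) ->
  (forall s, u < s < t -> ~ points s -> exists2 l, left_derivative w s l &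
     l + pull s * w s <= L * kappa s) ->
  w t <= L * gain.
Proof.
have [q [t0 [-> t0o]]] := period_reduction t.
move=> /andP[du ut] L0 wu lc rc dw.
set d := q%:~R * omega in du ut lc rc dw *.
apply: (@window_estimate_base (fun s => w (s + d)) L (u - d) t0) => //.
- by apply/andP; split; lra.
- by rewrite subrK.
- by move=> s us; apply: cvg_left_shift; apply: lc; lra.
- by move=> s us; apply: cvg_right_shift; apply: rc; lra.
- move=> s us ns.
  have [||l dl H] := dw (s + d); first by lra.
    by move=> /points_shift.
  exists l; first exact: left_derivative_shift.
  by move: H; rewrite (periodicz _ _ pull_per) (periodicz _ _ kappa_per).
Qed.

(** Where [w t > 0], let [v] be the last time with [w v <= 0].  On
    [[v, v + delay]] the window estimate applies; beyond, all delayed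
    arguments lie in the region where [w > 0], so [w] is nonincreasing. *)
Lemma overshoot w L u : 0 <= L ->
  (forall s, u <= s -> {for s, continuous w}) ->
  (forall s, u < s -> ~ points s -> exists2 l, left_derivative w s l &
     l + pull s * w s <= L * kappa s /\
     ((forall i, 0 <= w (s - (m i)%:R * omega)) -> l + pull s * w s <= 0)) ->
  w u <= 0 -> forall t, u <= t -> w t <= L * gain.
Proof.
move=> L0 cw dw wu t ut.
have [wt|wt] := leP (w t) 0.
  by apply: (le_trans wt); rewrite mulr_ge0 ?gain_ge0.
pose A := [set s | u <= s <= t /\ w s <= 0].
have Au : A u by split => //; rewrite lexx.
have supA : has_sup A by split; [exists u|exists t => s [/andP[]]].
pose v := sup A.
have uv : u <= v by apply: sup_upper_bound.
have vt : v <= t by apply: sup_le_ub; [exists u|move=> s [/andP[]]].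
have wv : w v <= 0.
  rewrite leNgt; apply/negP => wv0.
  have /cvgr_gt/(_ _ wv0) : w x @[x --> v^'-] --> w v.
    by apply: cvg_at_left_filter; exact: cw.
  move=> /near_leftP[d dv Hd].
  have [x [xut wx] dx] := sup_adherent (eps := v - d) ltac:(lra) supA.
  rewrite -/v subKr in dx.
  have : x <= v by apply: sup_upper_bound.
  rewrite le_eqVlt => /predU1P[xv|xv]; first by rewrite xv leNgt wv0 in wx.
  by have := Hd x; rewrite dx xv => /(_ isT); rewrite ltNge wx.
have wpos s : v < s -> s <= t -> 0 < w s.
  move=> vs st; rewrite ltNge; apply/negP => ws.
  have : s <= v.
    by apply: sup_upper_bound => //; split => //; rewrite st andbT; lra.
  by rewrite leNgt vs.
have lc s : u <= s -> w r @[r --> s^'-] --> w s.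
  by move=> us; apply: cvg_at_left_filter; exact: cw.
have rc s : u <= s -> w r @[r --> s^'+] --> w s.
  by move=> us; apply: cvg_at_right_filter; exact: cw.
have early t' : v <= t' -> t' <= v + delay -> w t' <= L * gain.
  move=> vt' t'd; apply: (@window_estimate w L v t') => //.
  - by apply/andP; split; lra.
  - by move=> s ?; apply: lc; lra.
  - by move=> s ?; apply: rc; lra.
  - move=> s /andP[vs _] ns.
    by have [|l dl [Hl _]] := dw s _ ns; [lra|exists l].
have [td|dt] := leP t (v + delay); first exact: early.
have d0 := delay_ge0.
apply: le_trans (early (v + delay) _ _) => //; last by rewrite lerDl.
apply: (@left_derivative_nonincreasing_off R points) => //.
- exact: (impulse_points_left_discrete omega_gt0 p_gt0 tauP).
- move=> s /andP[vs st] ns; have [|l dl [_ Hl]] := dw s _ ns; first by lra.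
  exists l => //.
  have ws : 0 < w s by apply: wpos; lra.
  have : l + pull s * w s <= 0.
    apply: Hl => i; apply/ltW/wpos; have := delay_le i; first by lra.
    have : 0 <= (m i)%:R * omega by rewrite mulr_ge0 ?ler0n ?ltW.
    lra.
  apply: le_trans; rewrite lerDl mulr_ge0 ?(ltW ws)//.
  by rewrite divr_ge0 ?equilibrium_production_ge0// ltW ?Nstar_gt0.
- by move=> s ?; apply: lc; lra.
- by move=> s ?; apply: rc; lra.
- exact: ltW.
Qed.

End window.

(** * Decay of a deviation of constant sign *)
Hypothesis n_gt0 : (0 < n)%N.

(** As [Nstar <= M], a single production term gives
    [pull s >= b i s * exp (- beta i s * M) / M], the inverse of a continuous
    periodic function. *)
Lemma pull_lower_bound : exists2 g, 0 < g & forall s, g <= pull s.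
Proof.
have [M M0 HM] := Nstar_bounded.
pose i := Ordinal n_gt0.
pose f s := M * expR (beta i s * M) / b i s.
have f0 s : 0 < f s by rewrite divr_gt0 ?mulr_gt0 ?expR_gt0.
have [|s|K HK] := @continuous_periodic_bounded f.
- move=> s; apply: cvgM; last by apply: cvgV; [rewrite gt_eqF|exact: b_cont].
  apply: cvgM; first exact: cvg_cst.
  apply: continuous_cvg; first exact: continuous_expR.
  by apply: cvgM; [exact: beta_cont|exact: cvg_cst].
- by rewrite /f b_per beta_per.
have K0 : 0 < K by apply: lt_le_trans (HK 0).
exists K^-1; first by rewrite invr_gt0.
move=> s; have : (f s)^-1 <= pull s.
  rewrite /f invf_div invfM mulrA -expRN mulrAC /pull.
  apply: ler_pM.
  - by rewrite mulr_ge0 ?expR_ge0// ltW.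
  - by rewrite invr_ge0 ltW.
  - rewrite /equilibrium_production (bigD1 i)//=.
    apply: ler_wpDr.
      by apply: sumr_ge0 => j _; rewrite mulr_ge0 ?expR_ge0// ltW.
    rewrite ler_pM2l// ler_expR mulNr lerN2 ler_pM2l//.
  - by rewrite lef_pV2 ?posrE ?Nstar_gt0.
by apply: le_trans; rewrite lef_pV2 ?posrE.
Qed.

(** [w] is nonincreasing; if it stayed above [e], it would decrease at least at
    the constant speed [g * e] and cease to be positive. *)
Lemma decay w u :
  (forall s, u <= s -> {for s, continuous w}) ->
  (forall s, u <= s -> 0 < w s) ->
  (forall s, u < s -> ~ points s -> exists2 l, left_derivative w s l &
     l + pull s * w s <= 0) ->
  forall e, 0 < e -> exists T, forall t, T <= t -> w t < e.
Proof.
move=> cw w0 dw e e0; have [g g0 Hg] := pull_lower_bound.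
have lc s : u <= s -> w r @[r --> s^'-] --> w s.
  by move=> us; apply: cvg_at_left_filter; exact: cw.
have rc s : u <= s -> w r @[r --> s^'+] --> w s.
  by move=> us; apply: cvg_at_right_filter; exact: cw.
have dX := impulse_points_left_discrete omega_gt0 p_gt0 tauP.
have [[T uT we]|Hn] := pselect (exists2 T, u <= T & w T < e).
  exists T => t Tt; apply: le_lt_trans we.
  apply: (@left_derivative_nonincreasing_off R points) => //.
  - move=> s /andP[Ts _] ns; have [|l dl Hl] := dw s _ ns; first by lra.
    exists l => //; apply: le_trans Hl; rewrite lerDl mulr_ge0//.
      by rewrite (le_trans _ (Hg s))// ltW.
    by apply/ltW/w0; lra.
  - by move=> s ?; apply: lc; lra.
  - by move=> s ?; apply: rc; lra.
have we s : u <= s -> e <= w s.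
  by move=> us; rewrite leNgt; apply/negP => ws; apply: Hn; exists s.
(* The time at which a decrease at speed [g * e] from [w u] reaches [0]. *)
pose v := u + w u / (g * e).
have ge0 : 0 < g * e by rewrite mulr_gt0.
have uv : u <= v by rewrite lerDl divr_ge0 ?ltW// w0.
have : w v + g * e * v <= w u + g * e * u.
  apply: (@left_derivative_nonincreasing_off R points
    (fun s => w s + g * e * s)) => //.
  - move=> s /andP[us _] ns; have [l dl Hl] := dw s us ns.
    have dlin : left_derivative (fun r => - (g * e) * r) s (- (g * e)).
      have := left_derivativeM (left_derivative_cst (- (g * e)) s)
        (is_derive_left_derivative (is_derive_id s 1)).
      by rewrite mul0r add0r mulr1.
    exists (l - - (g * e)).
      have := left_derivativeB dl dlin.
      by under eq_fun do rewrite mulNr opprK.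
    rewrite opprK; apply: le_trans Hl; rewrite lerD2l.
    by apply: ler_pM; [exact: ltW|exact: ltW|exact: Hg|exact/we/ltW].
  - move=> s ?; apply: cvgD; first by apply: lc; lra.
    apply: cvgM; first exact: cvg_cst.
    by apply: cvg_at_left_filter; exact: cvg_id.
  - move=> s ?; apply: cvgD; first by apply: rc; lra.
    apply: cvgM; first exact: cvg_cst.
    by apply: cvg_at_right_filter; exact: cvg_id.
have -> : g * e * v = g * e * u + w u.
  by rewrite /v mulrDr [g * e * (_ / _)]mulrC divfK// gt_eqF.
by have := w0 v uv; lra.
Qed.

(** * The relative deviation of a solution *)

(** Both rates bound the change of production, relative to [Nstar], per unit
    of relative deviation: the first one through the Lipschitz constant [1] of
    [exp (- x)] for [x >= 0], the second one through the slope of [exp (- x)]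
    at [x = beta i s * Nstar s]. *)
Definition lipschitz_rate s : R := \sum_(i < n) b i s * beta i s.
Definition linear_rate s : R :=
  \sum_(i < n) b i s * beta i s * expR (- beta i s * Nstar s).

Lemma linear_rate_ge0 s : 0 <= linear_rate s.
Proof. by apply: sumr_ge0 => i _; rewrite !mulr_ge0 ?expR_ge0// ltW. Qed.

Lemma lipschitz_rate_ge0 s : 0 <= lipschitz_rate s.
Proof. by apply: sumr_ge0 => i _; rewrite mulr_ge0 ?ltW. Qed.

Lemma linear_rate_le s : linear_rate s <= lipschitz_rate s.
Proof.
apply: ler_sum => i _; rewrite ler_piMr//.
  by rewrite mulr_ge0 ?ltW.
by rewrite -expR0 ler_expR mulNr oppr_le0 mulr_ge0 ?ltW ?Nstar_gt0.
Qed.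

Lemma lipschitz_rate_cont : continuous lipschitz_rate.
Proof.
move=> s; apply: cvg_big => [|i _]; first exact: add_continuous.
by apply: cvgM; [exact: b_cont|exact: beta_cont].
Qed.

Lemma linear_rate_cont s : ~ points s -> {for s, continuous linear_rate}.
Proof.
move=> ns; apply: cvg_big => [|i _]; first exact: add_continuous.
apply: cvgM; first by apply: cvgM; [exact: b_cont|exact: beta_cont].
apply: continuous_cvg; first exact: continuous_expR.
by apply: cvgM; [apply: cvgN; exact: beta_cont|exact: Nstar_cont].
Qed.

Lemma lipschitz_rate_per : periodic lipschitz_rate omega.
Proof. by move=> s; apply: eq_bigr => i _; rewrite b_per beta_per. Qed.

Lemma linear_rate_per : periodic linear_rate omega.
Proof.
by move=> s; apply: eq_bigr => i _; rewrite b_per beta_per Nstar_per.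
Qed.

Lemma gain_linear_rate : gain linear_rate = alpha1 omega m a b beta tau c Nstar.
Proof.
congr (sup (_ @` _)); apply/funext => t; congr (_ * _).
apply: eq_Rintegral => s _; rewrite /linear_rate mulr_suml.
apply: eq_bigr => i _.
by rewrite /weight /propagator expRD; ring.
Qed.

Lemma gain_lipschitz_rate :
  gain lipschitz_rate = alpha2 omega m a b beta tau c Nstar.
Proof.
congr (sup (_ @` _)); apply/funext => t; congr (_ * _).
apply: eq_Rintegral => s _; rewrite /lipschitz_rate mulr_suml.
apply: eq_bigr => i _.
by rewrite /weight /propagator; ring.
Qed.

Variable N : R -> R.
Hypothesis N_sol : solution omega m a b beta tau c N.
Hypothesis N0_gt0 : 0 < N 0.

Definition deviation s := N s / Nstar s - 1.

Lemma production_ge0 s : 0 <= production N s.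
Proof. by apply: sumr_ge0 => i _; rewrite mulr_ge0 ?expR_ge0// ltW. Qed.

Lemma N_gt0 t : 0 <= t -> 0 < N t.
Proof.
move=> t0.
have := propagated_le omega_gt0 p_gt0 tauP c_gtN1 a_cont
  (solution_impulsive N_sol) (fun r _ => production_ge0 r) (lexx 0) t0.
by apply: lt_le_trans; rewrite mulr_gt0 ?propagator_gt0.
Qed.

Lemma deviation_gtN1 t : 0 <= t -> -1 < deviation t.
Proof.
by move=> t0; rewrite /deviation ltrBrDl subrr divr_gt0 ?N_gt0 ?Nstar_gt0.
Qed.

Lemma N_deviation t : N t = Nstar t * (1 + deviation t).
Proof. by rewrite /deviation addrC subrK mulrC divfK// gt_eqF ?Nstar_gt0. Qed.

(** Multiplying numerator and denominator by a propagator turns both into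
    continuous functions. *)
Lemma deviation_cont t : 0 < t -> {for t, continuous deviation}.
Proof.
move=> t0.
have E : deviation = fun s => N s * propagator tau c a s (t + 1) /
    (Nstar s * propagator tau c a s (t + 1)) - 1.
  apply/funext => s; rewrite /deviation; congr (_ - 1).
  by rewrite -mulf_div divff ?mulr1// gt_eqF ?propagator_gt0.
have nz : Nstar t * propagator tau c a t (t + 1) != 0.
  by rewrite gt_eqF// mulr_gt0 ?propagator_gt0 ?Nstar_gt0.
have t1 : t < t + 1 by rewrite ltrDl.
have solN := solution_impulsive N_sol.
have solS := Nstar_impulsive 0.
apply/left_right_continuousP; rewrite E; split;
  (apply: cvgB; last exact: cvg_cst); apply: cvgM.
- exact: (propagated_left_cvg omega_gt0 p_gt0 tauP a_cont solN t0 (ltW t1)).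
- apply: cvgV => //.
  exact: (propagated_left_cvg omega_gt0 p_gt0 tauP a_cont solS t0 (ltW t1)).
- exact: (propagated_right_cvg omega_gt0 p_gt0 tauP c_gtN1 a_cont solN
    (ltW t0) t1).
- apply: cvgV => //.
  exact: (propagated_right_cvg omega_gt0 p_gt0 tauP c_gtN1 a_cont solS
    (ltW t0) t1).
Qed.

Lemma deviation_left_derivative s : 0 < s -> ~ points s ->
  exists2 l, left_derivative deviation s l &
    l + pull s * deviation s =
    (production N s - equilibrium_production s) / Nstar s.
Proof.
move=> s0 ns.
have [_ _ dN _] := solution_impulsive N_sol.
have [_ _ dS _] := Nstar_impulsive 0.
have nz : Nstar s != 0 by rewrite gt_eqF ?Nstar_gt0.
eexists.
  apply: left_derivativeB (left_derivative_cst 1 s).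
  exact: left_derivativeM (dN s s0 ns) (left_derivativeV nz (dS s s0 ns)).
by rewrite /deviation /pull; field.
Qed.

(** Since [m i * omega] is a multiple of the period,
    [N (s - m i * omega) = Nstar s * (1 + z (s - m i * omega))]. *)
Lemma production_gap s :
  (production N s - equilibrium_production s) / Nstar s =
  (\sum_(i < n) b i s * (expR (- (beta i s * Nstar s *
       (1 + deviation (s - (m i)%:R * omega)))) -
     expR (- (beta i s * Nstar s)))) / Nstar s.
Proof.
congr (_ / _); rewrite -sumrB; apply: eq_bigr => i _.
rewrite -mulrBr N_deviation (periodic_subn _ _ Nstar_per) !mulNr.
by rewrite mulrA.
Qed.

Lemma expRN_lipschitz (x y : R) : 0 <= x -> x <= y ->
  expR (- x) - expR (- y) <= y - x.
Proof.
move=> x0 xy.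
have -> : expR (- y) = expR (- x) * expR (x - y).
  by rewrite -expRD; congr expR; ring.
have h1 := expR_ge1Dx (x - y).
have h2 : expR (- x) <= 1 by rewrite -expR0 ler_expR oppr_le0.
have h3 := expR_gt0 (- x).
have h4 : expR (x - y) <= 1 by rewrite -expR0 ler_expR subr_le0.
rewrite -[X in X - _]mulr1 -mulrBr.
apply: (@le_trans _ _ (1 - expR (x - y))); last by lra.
by rewrite ler_piMl// subr_ge0.
Qed.

(** A term with a nonnegative delayed deviation is nonpositive.  For the others
    [z > -1] keeps the exponents [B * (1 + z)] and [B] nonnegative, where
    [exp (- x)] is 1-Lipschitz. *)
Lemma gap_upper s L : 0 <= L ->
  (forall i, -1 < deviation (s - (m i)%:R * omega)) ->
  (forall i, - L <= deviation (s - (m i)%:R * omega)) ->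
  (production N s - equilibrium_production s) / Nstar s <= L * lipschitz_rate s.
Proof.
move=> L0 z1 zL; rewrite production_gap ler_pdivrMr ?Nstar_gt0//.
rewrite /lipschitz_rate mulr_sumr mulr_suml; apply: ler_sum => i _.
set z := deviation _; set B := beta i s * Nstar s.
have B0 : 0 < B by rewrite mulr_gt0 ?Nstar_gt0.
have -> : L * (b i s * beta i s) * Nstar s = b i s * (B * L).
  by rewrite /B; ring.
rewrite ler_pM2l//.
have {}z1 : -1 < z by exact: z1.
have {}zL : - L <= z by exact: zL.
have [z0|z0] := leP 0 z.
  apply: (@le_trans _ _ 0); last by rewrite mulr_ge0// ltW.
  by rewrite subr_le0 ler_expR lerN2 ler_peMr ?(ltW B0)//; lra.
apply: (le_trans (expRN_lipschitz _ _)).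
- by rewrite mulr_ge0 ?(ltW B0)//; lra.
- by rewrite ler_piMr ?(ltW B0)//; lra.
- rewrite mulrDr mulr1 opprD addrA subrr add0r -mulrN ler_pM2l//; lra.
Qed.

Lemma gap_le0 s : (forall i, 0 <= deviation (s - (m i)%:R * omega)) ->
  (production N s - equilibrium_production s) / Nstar s <= 0.
Proof.
move=> z0; rewrite -(mul0r (lipschitz_rate s)); apply: gap_upper => // i.
- by apply: lt_le_trans (z0 i); rewrite oppr_lt0.
- by rewrite oppr0.
Qed.

(** Convexity: [exp (- B (1 + z)) - exp (- B) >= - exp (- B) * B * z]. *)
Lemma gap_lower s M :
  (forall i, deviation (s - (m i)%:R * omega) <= M) ->
  - (M * linear_rate s) <=
    (production N s - equilibrium_production s) / Nstar s.
Proof.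
move=> zM; rewrite production_gap ler_pdivlMr ?Nstar_gt0//.
rewrite /linear_rate mulr_sumr mulNr mulr_suml -sumrN; apply: ler_sum => i _.
set z := deviation _; set B := beta i s * Nstar s.
have B0 : 0 < B by rewrite mulr_gt0 ?Nstar_gt0.
rewrite mulNr -/B.
have -> : M * (b i s * beta i s * expR (- B)) * Nstar s =
    b i s * (B * M * expR (- B)) by rewrite /B; ring.
rewrite -mulrN ler_pM2l// mulrDr mulr1 opprD expRD.
have {}zM : z <= M by exact: zM.
have h1 := expR_ge1Dx (- (B * z)).
have h2 : B * z <= B * M by rewrite ler_pM2l.
have h3 := expR_gt0 (- B).
have : 0 <= expR (- B) * (expR (- (B * z)) - 1 + B * M).
  by rewrite mulr_ge0 ?(ltW h3)//; lra.
by rewrite -subr_ge0; congr (_ <= _); ring.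
Qed.

Lemma lipschitz_rate_bounded : exists K, forall s, lipschitz_rate s <= K.
Proof.
exact: continuous_periodic_bounded lipschitz_rate_cont lipschitz_rate_per.
Qed.

(** [z] is bounded above by what it may gain from delayed values that are at
    least [- L]; starting after [T + delay] puts all of these beyond [T]. *)
Lemma overshoot_above L T u : 0 <= L -> 0 <= T ->
  (forall s, T <= s -> - L <= deviation s) ->
  T + delay <= u -> 0 < u -> deviation u <= 0 ->
  forall t, u <= t -> deviation t <= L * gain lipschitz_rate.
Proof.
move=> L0 T0 zL Tu u0 zu; have [K HK] := lipschitz_rate_bounded.
apply: (@overshoot lipschitz_rate K) => //.
- by move=> s _; exact: lipschitz_rate_cont.
- exact: lipschitz_rate_ge0.
- exact: lipschitz_rate_per.
- by move=> s us; apply: deviation_cont; lra.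
- move=> s us ns.
  have [|l dl E] := deviation_left_derivative _ ns; first by lra.
  exists l => //; rewrite E; split; last exact: gap_le0.
  apply: gap_upper => // i; have := delay_le i.
    by move=> ?; apply: deviation_gtN1; lra.
  by move=> ?; apply: zL; lra.
Qed.

Lemma overshoot_below M T u : 0 <= M -> 0 <= T ->
  (forall s, T <= s -> deviation s <= M) ->
  T + delay <= u -> 0 < u -> 0 <= deviation u ->
  forall t, u <= t -> - (M * gain linear_rate) <= deviation t.
Proof.
move=> M0 T0 zM Tu u0 zu t ut; have [K HK] := lipschitz_rate_bounded.
rewrite -[leRHS]opprK lerN2.
apply: (@overshoot linear_rate K _ _ _ _ (fun s => - deviation s) M u) => //.
- exact: linear_rate_cont.
- exact: linear_rate_ge0.
- by move=> s; apply: le_trans (HK s); exact: linear_rate_le.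
- exact: linear_rate_per.
- by move=> s us; apply: cvgN; apply: deviation_cont; lra.
- move=> s us ns.
  have [|l dl E] := deviation_left_derivative _ ns; first by lra.
  exists (- l); first exact: left_derivativeN.
  rewrite mulrN -opprD E; split.
    rewrite lerNl; apply: gap_lower => i; have := delay_le i => ?.
    by apply: zM; lra.
  move=> zi; rewrite lerNl oppr0.
  have := @gap_lower s 0; rewrite mul0r oppr0; apply => i.
  by rewrite -oppr_ge0.
- by rewrite oppr_le0.
Qed.

(** Once all the delayed values are positive as well, production is at most
    its equilibrium value. *)
Lemma deviation_cvg0_positive T : 0 <= T ->
  (forall t, T <= t -> 0 < deviation t) ->
  forall e, 0 < e -> exists T', forall t, T' <= t -> deviation t < e.
Proof.
move=> T0 z0; have d0 := delay_ge0.
apply: (@decay deviation (T + delay + 1)).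
- by move=> s ?; apply: deviation_cont; lra.
- by move=> s ?; apply: z0; lra.
- move=> s ? ns; have [|l dl E] := deviation_left_derivative _ ns; first by lra.
  exists l => //; rewrite E; apply: gap_le0 => i.
  by have := delay_le i => ?; apply/ltW/z0; lra.
Qed.

Lemma deviation_cvg0_negative T : 0 <= T ->
  (forall t, T <= t -> deviation t < 0) ->
  forall e, 0 < e -> exists T', forall t, T' <= t -> - e < deviation t.
Proof.
move=> T0 z0 e e0; have d0 := delay_ge0.
have [||s ? ns|T' HT'] :=
  @decay (fun s => - deviation s) (T + delay + 1) _ _ _ e e0.
- by move=> s ?; apply: cvgN; apply: deviation_cont; lra.
- by move=> s ?; rewrite oppr_gt0; apply: z0; lra.
- have [|l dl E] := deviation_left_derivative _ ns; first by lra.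
  exists (- l); first exact: left_derivativeN.
  rewrite mulrN -opprD E lerNl oppr0.
  have := @gap_lower s 0; rewrite mul0r oppr0; apply => i.
  by have := delay_le i => ?; apply/ltW/z0; lra.
- by exists T' => t /HT'; rewrite ltrNl.
Qed.

Lemma gain_lipschitz_rate_ge0 : 0 <= gain lipschitz_rate.
Proof.
have [K HK] := lipschitz_rate_bounded.
apply: (@gain_ge0 _ K) => //; last exact: lipschitz_rate_ge0.
by move=> s _; exact: lipschitz_rate_cont.
Qed.

Lemma gain_linear_rate_ge0 : 0 <= gain linear_rate.
Proof.
have [K HK] := lipschitz_rate_bounded.
apply: (@gain_ge0 _ K); [exact: linear_rate_cont|exact: linear_rate_ge0|].
by move=> s; apply: le_trans (HK s); exact: linear_rate_le.
Qed.

(** The bounds improve in turn: [- L <= z] gives [z <= gain lipschitz_rate * L],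
    which gives [- q * L <= z].  The start [L = 1] is the positivity of [N]. *)
Lemma deviation_oscillating :
  (forall T, exists2 u, T <= u & deviation u <= 0) ->
  (forall T, exists2 u, T <= u & 0 <= deviation u) ->
  forall k, exists2 T, 0 <= T & forall t, T <= t ->
    - (gain linear_rate * gain lipschitz_rate) ^+ k <= deviation t <=
      gain lipschitz_rate * (gain linear_rate * gain lipschitz_rate) ^+ k.
Proof.
move=> below above; have d0 := delay_ge0.
set q := gain linear_rate * gain lipschitz_rate.
have g1 := gain_linear_rate_ge0; have g2 := gain_lipschitz_rate_ge0.
have q0 : 0 <= q by rewrite mulr_ge0.
have up L T : 0 <= L -> 0 <= T -> (forall s, T <= s -> - L <= deviation s) ->
    exists2 T', T <= T' & forall t, T' <= t ->
      deviation t <= L * gain lipschitz_rate.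
  move=> L0 T0 zL; have [u Tu zu] := below (T + delay + 1).
  exists u; first by lra.
  apply: (@overshoot_above L T) => //; lra.
have down M T : 0 <= M -> 0 <= T -> (forall s, T <= s -> deviation s <= M) ->
    exists2 T', T <= T' & forall t, T' <= t ->
      - (M * gain linear_rate) <= deviation t.
  move=> M0 T0 zM; have [u Tu zu] := above (T + delay + 1).
  exists u; first by lra.
  apply: (@overshoot_below M T) => //; lra.
have close L T : 0 <= L -> 0 <= T -> (forall s, T <= s -> - L <= deviation s) ->
    exists2 T', 0 <= T' & forall t, T' <= t ->
      - L <= deviation t <= gain lipschitz_rate * L.
  move=> L0 T0 zL; have [T' TT' HT'] := up L T L0 T0 zL.
  exists T'; first by lra.
  by move=> t T't; rewrite zL ?[_ * L]mulrC ?HT'//; lra.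
elim=> [|k [T T0 HT]].
  apply: (close 1 0) => // s s0; exact/ltW/deviation_gtN1.
have [T' TT' HT'] := down (gain lipschitz_rate * q ^+ k) T
  (mulr_ge0 g2 (exprn_ge0 _ q0)) T0 (fun s Ts => proj2 (andP (HT s Ts))).
apply: (close (q ^+ k.+1) T'); first exact: exprn_ge0.
- by lra.
- move=> s /HT'.
  rewrite (_ : gain lipschitz_rate * q ^+ k * _ = q ^+ k.+1)//.
  by rewrite exprS {2}/q; ring.
Qed.

(** Either [z] is eventually of one sign, or it returns to both sides of [0]
    at arbitrarily late times. *)
Lemma deviation_cvg0 : gain linear_rate * gain lipschitz_rate < 1 ->
  forall e, 0 < e -> exists T, forall t, T <= t -> `|deviation t| < e.
Proof.
move=> q1 e e0.
have [[T HT]|npos] := pselect (exists T, forall t, T <= t -> 0 < deviation t).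
  have [||T' HT'] := @deviation_cvg0_positive (Num.max T 0) _ _ e e0.
  - by rewrite le_max lexx orbT.
  - by move=> t; rewrite ge_max => /andP[/HT].
  exists (Num.max T T') => t; rewrite ge_max => /andP[/HT z0 /HT' ze].
  by rewrite gtr0_norm.
have [[T HT]|nneg] := pselect (exists T, forall t, T <= t -> deviation t < 0).
  have [||T' HT'] := @deviation_cvg0_negative (Num.max T 0) _ _ e e0.
  - by rewrite le_max lexx orbT.
  - by move=> t; rewrite ge_max => /andP[/HT].
  exists (Num.max T T') => t; rewrite ge_max => /andP[/HT z0 /HT' ze].
  by rewrite ltr0_norm// ltrNl.
have below T : exists2 u, T <= u & deviation u <= 0.
  apply: contrapT => H; apply: npos; exists T => t Tt.
  by rewrite ltNge; apply/negP => zt; apply: H; exists t.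
have above T : exists2 u, T <= u & 0 <= deviation u.
  apply: contrapT => H; apply: nneg; exists T => t Tt.
  by rewrite ltNge; apply/negP => zt; apply: H; exists t.
have g1 := gain_linear_rate_ge0; have g2 := gain_lipschitz_rate_ge0.
set q := gain linear_rate * gain lipschitz_rate in q1.
have q0 : 0 <= q by rewrite mulr_ge0.
have e'0 : 0 < e / (1 + gain lipschitz_rate) by rewrite divr_gt0//; lra.
have : `|q| < 1 by rewrite ger0_norm.
move=> /cvg_expr/cvgrPdist_lt/(_ _ e'0)[k _ /(_ k (leqnn k))].
rewrite sub0r normrN ger0_norm ?exprn_ge0// ltr_pdivlMr; last by lra.
move=> qke; have [T _ HT] := deviation_oscillating below above k.
exists T => t /HT; rewrite -/q => /andP[lo hi].
have qk0 : 0 <= q ^+ k by rewrite exprn_ge0.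
have gq0 : 0 <= gain lipschitz_rate * q ^+ k by rewrite mulr_ge0.
have E : q ^+ k * (1 + gain lipschitz_rate) =
  q ^+ k + gain lipschitz_rate * q ^+ k by ring.
rewrite E in qke.
by rewrite ltr_norml; apply/andP; split; lra.
Qed.

Lemma difference_cvg0 : gain linear_rate * gain lipschitz_rate < 1 ->
  N t - Nstar t @[t --> +oo] --> 0.
Proof.
move=> q1; have [M M0 HM] := Nstar_bounded.
apply/cvgrPdist_lt => e e0.
have [T HT] := deviation_cvg0 q1 (divr_gt0 e0 M0).
exists T; split => [|t /ltW/HT zt]; first exact: num_real.
have -> : 0 - (N t - Nstar t) = - (deviation t * Nstar t).
  by rewrite N_deviation; ring.
rewrite normrN normrM (gtr0_norm (Nstar_gt0 t)).
apply: (@le_lt_trans _ _ (`|deviation t| * M)); first by rewrite ler_wpM2l.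
by rewrite -ltr_pdivlMr.
Qed.

End periodic_solution.

Theorem theorem3p5 (R : realType) (omega : R) (n p : nat) (m : 'I_n -> nat)
  (a : R -> R) (b beta : 'I_n -> R -> R) (tau c : int -> R) (Nstar : R -> R)
  (omega_gt0 : 0 < omega) (n_gt0 : (0 < n)%N) (p_gt0 : (0 < p)%N)
  (m_gt0 : forall i, (0 < m i)%N)
  (a_cont : continuous a) (a_gt0 : forall t, 0 < a t) (a_per : periodic a omega)
  (b_cont : forall i, continuous (b i)) (b_gt0 : forall i t, 0 < b i t)
  (b_per : forall i, periodic (b i) omega)
  (beta_cont : forall i, continuous (beta i))
  (beta_gt0 : forall i t, 0 < beta i t)
  (beta_per : forall i, periodic (beta i) omega)
  (tauP : impulse_times omega p tau)
  (c_gtN1 : forall k : int, -1 < c k)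
  (c_per : forall k : int, c (k + p%:Z) = c k)
  (c_prod : \prod_(1 <= k < p.+1) (1 + c k%:Z) <= 1)
  (NstarP : periodic_positive_solution omega m a b beta tau c Nstar)
  (alpha12 : alpha1 omega m a b beta tau c Nstar *
             alpha2 omega m a b beta tau c Nstar < 1) :
  forall N : R -> R, positive_solution omega m a b beta tau c N ->
    N t - Nstar t @[t --> +oo] --> 0.
Proof.
move=> N [N_sol [phi [_ _ phi0] Nphi]].
apply: (difference_cvg0 omega_gt0 p_gt0 a_cont a_per b_cont b_gt0 b_per
  beta_cont beta_gt0 beta_per tauP c_gtN1 c_per NstarP n_gt0 N_sol).
- rewrite Nphi// in_itv/= lexx andbT oppr_le0; apply: mulr_ge0 => //.
  exact: ltW.
- by rewrite gain_linear_rate gain_lipschitz_rate.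
Qed.
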